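(* Let $p>2$ be prime and $k=\overline{\mathbb{F}}_p$. Let $F_1,\ldots,F_m\in k[t][x]$, $r_i=\deg_xF_i>0$, be pairwise non-associate, irreducible, monic in $x$ and separable over $k(t)$. Let $n\ge3$ with $n\ge\operatorname{sl}F_i$ for all $i$. Let $a_0,\ldots,a_n$ be free variables, $\mathbf{a}=(a_0,\dots,a_n)$, $\mathbf{f}=\sum_{j=0}^na_jt^j$, $N_i=\deg_tF_i(t,\mathbf{f})=r_in$. Let $L$ be the splitting field of $\prod_{i=1}^mF_i(t,\mathbf{f})$ over $k(\mathbf{a})$ and $G=\mathrm{Gal}(L/k(\mathbf{a}))$, viewed as a subgroup of $S_{N_1}\times\cdots\times S_{N_m}$ via its action on the roots of each $F_i(t,\mathbf{f})$. Then $G=S_{N_1}\times\cdots\times S_{N_m}$.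
   Context: For $P(t,x)=\sum_{j=0}^r c_j(t)x^j$ monic in $x$, $\operatorname{sl}P=\max_{1\le j\le r}\frac{\deg c_{r-j}(t)}{j}$ (with $\deg0=-\infty$). Separable over $k(t)$ means $F_i\notin k[t][x^p]$. Non-associate means no two differ by a nonzero constant factor. *)

(* Defs.v *)
From HB Require Import structures.
From mathcomp Require Import all_boot all_order all_algebra all_fingroup all_field.
Set Implicit Arguments. Unset Strict Implicit. Unset Printing Implicit Defensive.
Import GRing.Theory.
Local Open Scope ring_scope.

Fixpoint mpoly (k : idomainType) (n : nat) : idomainType :=
  match n with 0 => k | m.+1 => ({poly mpoly k m} : idomainType) end.

Fixpoint mconst (k : idomainType) (n : nat) : k -> mpoly k n :=
  match n return k -> mpoly k n with
  | 0 => fun c => c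
  | m.+1 => fun c => (@mconst k m c)%:P
  end.

Fixpoint mvar (k : idomainType) (n : nat) (j : nat) : mpoly k n :=
  match n return mpoly k n with
  | 0 => 0
  | m.+1 => if j == m then 'X else (@mvar k m j)%:P
  end.

Definition ratfun (k : idomainType) (n : nat) : fieldType := {fraction mpoly k n}.

Definition rconst (k : idomainType) (n : nat) (c : k) : ratfun k n :=
  tofrac (@mconst k n c).

Definition rvar (k : idomainType) (n : nat) (j : nat) : ratfun k n :=
  tofrac (@mvar k n j).

Definition generic_f (k : idomainType) (n : nat) : {poly ratfun k n.+1} :=
  \sum_(j < n.+1) (@rvar k n.+1 j)%:P * 'X^j.

(* F(t, f) for F in k[t][x] (outer variable x, coefficients in k[t]),
   as a polynomial in t over k(a_0..a_n). *)
Definition subst_f (k : idomainType) (n : nat) (F : {poly {poly k}})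
  : {poly ratfun k n.+1} :=
  (map_poly (map_poly (@rconst k n.+1)) F).[@generic_f k n].

(* k is an algebraic closure of F_p: algebraically closed, of characteristic p,
   and algebraic over F_p (every element lies in some F_{p^e}). *)
Definition is_Fpbar (p : nat) (k : closedFieldType) : Prop :=
  p \in [pchar k] /\ forall x : k, exists e : nat, (0 < e)%N /\ x ^+ (p ^ e) = x.

Definition ring_irreducible (R : comUnitRingType) (x : R) : Prop :=
  [/\ x != 0, x \isn't a GRing.unit &
      forall y z : R, x = y * z -> y \is a GRing.unit \/ z \is a GRing.unit].

(* Separable over k(t): F not in k[t][x^p]. *)
Definition sep_over (k : idomainType) (p : nat) (F : {poly {poly k}}) : Prop :=
  exists2 j : nat, ~~ (p %| j)%N & F`_j != 0.

(* n >= sl F, where sl F = max_{1<=j<=r} deg c_{r-j} / j (deg 0 = -oo),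
   r = deg_x F; unfolded: every nonzero c_{r-j} has deg <= n*j. *)
Definition sl_le (k : idomainType) (F : {poly {poly k}}) (n : nat) : Prop :=
  let r := (size F).-1 in
  forall j : nat, (1 <= j)%N -> (j <= r)%N ->
    let c : {poly k} := F`_(r - j) in
    c != 0 -> leq (size c).-1 (muln n j).

(* Main.v *)
(** Let R_i be the set of roots of F_i(t, f). The Galois group G is the full product as soon as it
    acts doubly transitively on every R_i and contains, for every i, a transposition of R_i fixing
    all the other roots: the conjugates of these transpositions generate the product.

    Both facts are obtained from embeddings of k(a) into larger fields M, that is from other
    polynomials g in place of f; an orbit of Gal over M on the roots of F_i(t, g) is contained in an
    orbit of G. Each map a |-> coefficients of g is injective because some specialization of the new
    parameter gives f back.

    Transitivity comes from g = f + u (t - x0)^e with a new variable u, where x0 is a root: for e = 0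
    and e = 1 the cofactor of (t - x0)^e in F_i(t, g) is irreducible over L(u), hence G is transitive
    and a point stabilizer is transitive on the other roots. Irreducibility holds because
    x = f + u (t - x0)^e is a change of variable between u and x, so that a factorization would yield
    one of F_i, which is absolutely irreducible since k is algebraically closed.

    For the transposition, g is chosen over Om[[s]] so that at s = 0 its graph is tangent to the curve
    F_i = 0 at the point (x0, f(x0)) and meets all the curves transversally elsewhere. By Hensel's
    lemma all the roots of the F_j(t, g) but two are power series; the other two are the roots of an
    Eisenstein quadratic polynomial, which is irreducible and, as p > 2, separable. The tangent graph
    is again a member of a pencil, with e = 2, so that the other intersections are simple
    unless the derivative in t of an irreducible polynomial vanishes; adding a suitable constant
    multiple of (t - x0)^3 excludes this. *)
Require Import Defs.
From HB Require Import structures.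
From mathcomp Require Import all_boot all_order all_algebra all_fingroup all_field.
From mathcomp Require Import generic_quotient zify ring boolp.
Set Implicit Arguments.
Unset Strict Implicit.
Unset Printing Implicit Defensive.
Import GRing.Theory.
Local Open Scope ring_scope.


(** * Factoring over {poly K} and absolute irreducibility *)

Section Gauss.
Variable K : fieldType.
Implicit Types (p q c d : {poly K}) (g h S : {poly {poly K}}).

Lemma irreducible_factor c : (1 < size c)%N ->
  exists2 q, irreducible_poly q & q %| c.
Proof.
elim: {c}(size c) {-2}c (leqnn (size c)) => [|m IH] c szc c1.
  by move: szc; rewrite leqn0 => /eqP szc; rewrite szc in c1.
case: (pselect (irreducible_poly c)) => [irc|nirc]; first by exists c.
have [q [q1 qc neq]] : exists q, [/\ size q != 1, q %| c & ~~ (q %= c)].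
  apply: contrapT => H; apply: nirc; split=> // q q1 qc; apply/negPn/negP => neq.
  by apply: H; exists q.
have c0 : c != 0 by rewrite -size_poly_gt0 ltnW.
have ltq : (size q < size c)%N.
  rewrite ltn_neqAle dvdp_leq // andbT.
  by apply: contra neq; rewrite dvdp_size_eqp.
have q0 : q != 0 by apply: contraNneq c0 => q0; rewrite -dvd0p -q0.
have [||r irr rq] := IH q.
- by rewrite -ltnS (leq_trans ltq).
- by rewrite ltn_neqAle eq_sym q1 size_poly_gt0.
by exists r => //; apply: dvdp_trans rq qc.
Qed.

Lemma irreducible_dvdpM q c d : irreducible_poly q -> q %| c * d ->
  (q %| c) || (q %| d).
Proof.
move=> irq qcd; have [//|nqc] /= := boolP (q %| c).
have cop : coprimep q c.
  have [g1|g1] := eqVneq (size (gcdp q c)) 1; first by rewrite /coprimep g1.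
  have /(_ g1 (dvdp_gcdl _ _)) E := irq.2 (gcdp q c).
  by rewrite -(eqp_dvdl _ E) dvdp_gcdr in nqc.
by rewrite -(Gauss_dvdpr _ cop).
Qed.

(** Gauss's argument: for the least i and j with q dividing neither g_i nor h_j, every other term of
    the coefficient of index i + j of g h is divisible by q. *)
Lemma irreducible_dvd_coefM q g h : irreducible_poly q ->
  (forall i, q %| (g * h)`_i) -> (forall i, q %| g`_i) \/ (forall i, q %| h`_i).
Proof.
move=> irq qgh; apply: contrapT => /not_orP[ng nh].
have ex S : ~ (forall i, q %| S`_i) -> exists i, ~~ (q %| S`_i).
  by move=> nS; apply: contrapT => H; apply: nS => i; apply/negPn/negP => ?; apply: H; exists i.
case: (ex_minnP (ex _ ng)) => i ngi mini; case: (ex_minnP (ex _ nh)) => j nhj minj.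
suff /(irreducible_dvdpM irq) : q %| g`_i * h`_j by rewrite (negbTE ngi) (negbTE nhj).
have := qgh (i + j)%N; rewrite coefM.
have lti : (i < (i + j).+1)%N by rewrite ltnS leq_addr.
rewrite (bigD1 (Ordinal lti)) //= addKn dvdp_addl //.
apply: (big_ind (fun s => q %| s)) => [|a b|l nl]; first exact: dvdp0.
  exact: dvdp_add.
have [lti'|] := ltnP l i.
  by apply: dvdp_mulr; apply/negPn/negP => /mini; rewrite leqNgt lti'.
rewrite leq_eqVlt => /orP[/eqP il|il].
  by case/negP: nl; apply/eqP/val_inj.
apply: dvdp_mull; apply/negPn/negP => /minj; rewrite leqNgt.
by have := ltn_ord l; lia.
Qed.

Lemma dvd_coefP q g : (forall i, q %| g`_i) -> {g' | g = q%:P * g'}.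
Proof.
move=> qg; exists (map_poly (fun c => c %/ q) g).
by apply/polyP => i; rewrite coefCM coef_map_id0 ?div0p // mulrC divpK.
Qed.

(* The denominator c is cancelled one irreducible factor at a time. *)
Lemma gauss_lemma c S g h : c != 0 -> S != 0 -> c%:P * S = g * h ->
  exists g' h', [/\ S = g' * h', size g' = size g & size h' = size h].
Proof.
elim: {c}(size c) {-2}c (leqnn (size c)) g h => [|m IH] c szc g h c0 S0 E.
  by move: szc; rewrite leqn0 size_poly_eq0 (negbTE c0).
have [c1|] := leqP (size c) 1.
  have [a a0 ca] : exists2 a, a != 0 & c = a%:P.
    by exists c`_0; [rewrite -polyC_eq0 -size1_polyC | exact: size1_polyC].
  have ua : (a^-1)%:P%:P * c%:P = 1 :> {poly {poly K}}.
    by rewrite ca -!rmorphM /= mulVf.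
  exists ((a^-1)%:P%:P * g), h; split=> //; first by rewrite -mulrA -E mulrA ua mul1r.
  by rewrite size_Cmul // polyC_eq0 invr_eq0.
case/irreducible_factor => q irq /dvdpP[c' Ec].
have q0 : q != 0 := irredp_neq0 irq.
have c'0 : c' != 0 by apply: contraNneq c0 => c'0; rewrite Ec c'0 mul0r.
have szc' : (size c' <= m)%N.
  by move: szc; rewrite Ec size_mul //; case: irq => + _; move: (size c') (size q) => a b /= *; lia.
have qP0 : q%:P != 0 :> {poly {poly K}} by rewrite polyC_eq0.
have : forall i, q %| (g * h)`_i.
  by move=> i; rewrite -E coefCM Ec -mulrA mulrCA dvdp_mulr.
case/(irreducible_dvd_coefM irq) => /dvd_coefP[s Es].
  have E' : c'%:P * S = s * h.
    by apply: (mulfI qP0); rewrite !mulrA -Es -E -rmorphM /= Ec [c' * q]mulrC.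
  have [g' [h' [ES sg sh]]] := IH c' szc' s h c'0 S0 E'.
  by exists g', h'; rewrite Es size_Cmul.
have E' : c'%:P * S = g * s.
  by apply: (mulfI qP0); rewrite [RHS]mulrCA -Es -E mulrA -rmorphM /= Ec [c' * q]mulrC.
have [g' [h' [ES sg sh]]] := IH c' szc' g s c'0 S0 E'.
by exists g', h'; rewrite Es size_Cmul.
Qed.
End Gauss.

(** * Descent of monic factors to an algebraically closed field *)

Section AbsoluteIrreducibility.
Variables (k : closedFieldType) (K : fieldType) (iota : {rmorphism k -> K}).

Lemma avoid_seq (s : seq k) : exists c, c \notin s.
Proof.
have /closed_nonrootP[c] : \prod_(x <- s) ('X - x%:P) != 0 :> {poly k}.
  exact: monic_neq0 (monic_prod_XsubC _ _ _).
by rewrite root_prod_XsubC; exists c.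
Qed.

(** Induction on the size: subtract the value at one point c and divide by X - c; away from c the
    quotient again takes values in the image of [iota]. The list [s] records the points already
    used, and [k] is infinite. *)
Lemma poly_descent (g : {poly K}) (s : seq k) :
  (forall c, c \notin s -> exists a, g.[iota c] = iota a) ->
  exists g0, g = map_poly iota g0.
Proof.
elim: {g}(size g) {-2}g (leqnn (size g)) s => [|m IH] g szg s gP.
  by exists 0; rewrite rmorph0; apply/eqP; rewrite -size_poly_leq0.
have [c cs] := avoid_seq s; have [a ga] := gP c cs.
have : root (g - (iota a)%:P) (iota c) by rewrite rootE !hornerE ga subrr.
case/factor_theorem => g1 Eg1.
have Eg : g = g1 * ('X - (iota c)%:P) + (iota a)%:P by rewrite -Eg1 subrK.
have [||g0 Eg0] := IH g1 _ (c :: s).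
- have [-> |g10] := eqVneq g1 0; first by rewrite size_poly0.
  have: (size (g - (iota a)%:P)%R <= m.+1)%N.
    apply: leq_trans (size_polyD _ _) _; rewrite geq_max szg size_polyN.
    by apply: leq_trans (size_polyC_leq1 _) _.
  by rewrite Eg1 size_Mmonic ?monicXsubC // size_XsubC addn2.
- move=> d; rewrite inE negb_or => /andP[dc /gP[b gb]].
  exists ((b - a) / (d - c)); rewrite fmorph_div !rmorphB /= -ga -gb.
  have ne : iota d - iota c != 0 by rewrite -rmorphB fmorph_eq0 subr_eq0.
  by apply: (mulIf ne); rewrite divfK // Eg !hornerE subrr mulr0 add0r addrK.
exists (g0 * ('X - c%:P) + a%:P).
by rewrite Eg Eg0 rmorphD rmorphM /= map_polyXsubC map_polyC.
Qed.

(** For c in [k] the polynomial F(c, x) splits over [k], so its monic divisor g(c, x) has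
    coefficients in the image of [iota]; [poly_descent] then applies to each coefficient of g. *)
Lemma monic_dvd_descent (F : {poly {poly k}}) (g h : {poly {poly K}}) :
    map_poly (map_poly iota) F = g * h -> g \is monic -> F \is monic ->
  exists g0, g = map_poly (map_poly iota) g0.
Proof.
move=> E mg mF.
have gP i : exists g0 : {poly k}, g`_i = map_poly iota g0.
  apply: (@poly_descent _ [::]) => c _; pose ev := map_poly (horner_eval (iota c)).
  have [r Er] := closed_field_poly_normal (map_poly (horner_eval c) F).
  have lF : lead_coef (map_poly (horner_eval c) F) = 1.
    by apply/eqP; rewrite -monicE; apply: monic_map.
  have Eev : ev g * ev h = \prod_(z <- map iota r) ('X - z%:P).
    rewrite -rmorphM /= -E /ev -map_poly_comp big_map.
    transitivity (map_poly iota (map_poly (horner_eval c) F)).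
      rewrite -map_poly_comp; apply: eq_map_poly => p /=.
      by rewrite !horner_evalE horner_map.
    rewrite Er lF scale1r rmorph_prod /=; apply: eq_bigr => z _.
    by rewrite map_polyXsubC.
  have : ev g %| \prod_(z <- map iota r) ('X - z%:P) by rewrite -Eev dvdp_mulr.
  case/dvdp_prod_XsubC => mk.
  have mev : ev g \is monic by apply: monic_map.
  rewrite eqp_monic ?monic_prod_XsubC // => /eqP Em.
  exists ((\prod_(z <- mask mk r) ('X - z%:P))`_i).
  have -> : (g`_i).[iota c] = (ev g)`_i by rewrite coef_map.
  rewrite Em -map_mask big_map -coef_map rmorph_prod /=; congr (_`_i).
  by congr polyseq; apply: eq_bigr => z _; rewrite map_polyXsubC.
have {}gP i : exists g0 : {poly k}, g`_i == map_poly iota g0.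
  by have [g0 ->] := gP i; exists g0.
exists (\poly_(i < size g) xchoose (gP i)).
apply/polyP => i; rewrite coef_map coef_poly /=.
case: ltnP => [_|le]; first exact/eqP/(xchooseP (gP i)).
by rewrite nth_default // rmorph0.
Qed.

(** A factor of size 1 is constant in x, and it is a unit when F is monic, since the leading
    coefficients of the two factors multiply to 1. Hence irreducibility can be tested on
    x-degrees. *)
Definition irr_monic (F : {poly {poly k}}) := F \is monic /\
  forall g h, F = g * h -> size g = 1 \/ size h = 1.

Lemma absolutely_irreducible F (g h : {poly {poly K}}) : irr_monic F ->
  map_poly (map_poly iota) F = g * h -> size g = 1 \/ size h = 1.
Proof.
case=> mF irF E.
have mFK : map_poly (map_poly iota) F \is monic by apply: monic_map.
have Elc : lead_coef g * lead_coef h = 1 by rewrite -lead_coefM -E (monicP mFK).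
(* As the leading coefficients have product 1, scaling each factor by that of the other makes both
   monic and keeps the product. *)
pose g1 := (lead_coef h)%:P * g; pose h1 := (lead_coef g)%:P * h.
have E1 : map_poly (map_poly iota) F = g1 * h1.
  by rewrite /g1 /h1 mulrACA -rmorphM /= [_ * lead_coef g]mulrC Elc mul1r.
have mg1 : g1 \is monic by rewrite monicE lead_coefM lead_coefC mulrC Elc.
have mh1 : h1 \is monic by rewrite monicE lead_coefM lead_coefC Elc.
have lg0 : lead_coef g != 0 by apply: contra_eq_neq Elc => ->; rewrite mul0r eq_sym oner_eq0.
have lh0 : lead_coef h != 0 by apply: contra_eq_neq Elc => ->; rewrite mulr0 eq_sym oner_eq0.
have [g0 Eg0] := monic_dvd_descent E1 mg1 mF.
have [h0 Eh0] : exists h0, h1 = map_poly (map_poly iota) h0.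
  by apply: (monic_dvd_descent _ mh1 mF); rewrite mulrC; apply: E1.
have inj : injective (map_poly (map_poly iota)).
  by apply: map_inj_poly (rmorph0 _); apply: map_poly_inj.
have : F = g0 * h0 by apply: inj; rewrite rmorphM /= -Eg0 -Eh0.
have szm p : size (map_poly (map_poly iota) p) = size p.
  by apply: size_map_inj_poly; rewrite ?rmorph0 //; apply: map_poly_inj.
have sg : size g = size g0 by rewrite -szm -Eg0 size_Cmul.
have sh : size h = size h0 by rewrite -szm -Eh0 size_Cmul.
by move/irF; rewrite sg sh.
Qed.
End AbsoluteIrreducibility.

(** * Pencils of graphs *)

Section Fractions.
Variable R : idomainType.
Local Notation tofrac := (@FracField.tofrac R).

Lemma fractionP (x : {fraction R}) : exists a b, b != 0 /\ x = tofrac a / tofrac b.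
Proof.
elim/quotW: x => r; exists r.1, r.2; split; first exact: denom_ratioP.
apply: (@mulIf _ (tofrac r.2)); first by rewrite tofrac_eq0 denom_ratioP.
rewrite divfK ?tofrac_eq0 ?denom_ratioP //; unlock FracField.tofrac.
rewrite -[LHS]FracField.pi_mul; apply/eqmodP; rewrite /= FracField.equivfE.
by rewrite /FracField.mulf /= !numden_Ratio ?oner_eq0 ?mulr1 ?denom_ratioP // mulrC.
Qed.

Lemma tofrac_inj : injective tofrac.
Proof. by move=> x y /eqP; rewrite tofrac_eq => /eqP. Qed.
End Fractions.

(* The concrete quotient {fraction R} is expensive to compute with, so that what follows uses an
   arbitrary field of fractions. *)
Definition fraction_field (R : idomainType) (M : fieldType) (tau : {rmorphism R -> M}) :=
  injective tau /\ forall x, exists a b, b != 0 /\ x = tau a / tau b.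

Lemma tofrac_fraction_field (R : idomainType) :
  fraction_field (@FracField.tofrac R : {rmorphism R -> {fraction R}}).
Proof. by split; [apply: tofrac_inj | apply: fractionP]. Qed.

Lemma fraction_field_exists (R : idomainType) :
  exists (M : fieldType) (tau : {rmorphism R -> M}), fraction_field tau.
Proof. by exists {fraction R}; eexists; apply: tofrac_fraction_field. Qed.

Section FractionField.
Variables (R : idomainType) (M : fieldType) (tau : {rmorphism R -> M}).
Hypothesis tauP : fraction_field tau.

Lemma fraction_eq0 a : (tau a == 0) = (a == 0).
Proof. by rewrite -(rmorph0 tau) (inj_eq tauP.1). Qed.

Lemma clear_denominators (q : {poly M}) :
  exists c (q0 : {poly R}), c != 0 /\ map_poly tau q0 = tau c *: q.
Proof.
elim/poly_ind: q => [|q x [c [q0 [c0 E]]]].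
  by exists 1, 0; rewrite oner_neq0 rmorph0 scaler0.
have [a [b [b0 ->]]] := tauP.2 x.
exists (c * b), (b%:P * q0 * 'X + (c * a)%:P); rewrite mulf_neq0 //; split=> //.
rewrite rmorphD !rmorphM /= map_polyX !map_polyC /= E scalerDr.
congr (_ + _); first by rewrite -!mul_polyC polyCM; ring.
rewrite -mul_polyC -!polyCM; congr _%:P.
by field; rewrite fraction_eq0.
Qed.

Lemma size_map_fraction (p : {poly R}) : size (map_poly tau p) = size p.
Proof. by rewrite size_map_inj_poly ?rmorph0 //; apply: tauP.1. Qed.
End FractionField.

Section Pencil.
Variables (k : closedFieldType) (K : fieldType) (iota : {rmorphism k -> K}).
Implicit Types (F : {poly {poly k}}) (A B W : {poly K}).

(** A + u B in K[u][t]: the outer variable is t, the inner one is u. *)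
Definition pencil A B : {poly {poly K}} :=
  map_poly polyC A + 'X%:P * map_poly polyC B.

(* F(t, g(t)), over any ring R receiving k. *)
Definition subst (R : comNzRingType) (j : {rmorphism k -> R}) F (g : {poly R}) :
  {poly R} := (map_poly (map_poly j) F).[g].

(** Exchanging t and u turns substitution of the pencil into composition with the affine polynomial
    A + B u over K[t], which is the change of variable between x and u. *)
Lemma swap_horner_pencil (T : {poly {poly K}}) A B :
  swapXY ((map_poly (map_poly polyC) T).[pencil A B]) = T \Po (A%:P + 'X * B%:P).
Proof.
rewrite -horner_map /comp_poly; congr (_.[_]).
  by rewrite -!map_poly_comp; apply: eq_map_poly => c /=; rewrite swapXY_map_polyC.
rewrite /pencil rmorphD rmorphM /= !swapXY_map_polyC.
by rewrite swapXY_polyC map_polyX -[X in _ + X * _]swapXYK swapXY_X.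
Qed.

Lemma subst_polyC (F : {poly {poly k}}) (g : {poly {poly K}}) :
  subst (polyC \o iota) F g = (map_poly (map_poly polyC) (map_poly (map_poly iota) F)).[g].
Proof.
rewrite /subst -map_poly_comp; congr (_.[_]).
by apply: eq_map_poly => c /=; rewrite map_poly_comp.
Qed.

Lemma swap_subst_pencil F A B :
  swapXY (subst (polyC \o iota) F (pencil A B)) =
  map_poly (map_poly iota) F \Po (A%:P + 'X * B%:P).
Proof. by rewrite subst_polyC swap_horner_pencil. Qed.

(** The witness s' is B^e s((x - A) / B): the inverse change of variable, with denominators
    cleared. *)
Lemma homogenize A B (s : {poly {poly K}}) : B != 0 ->
  exists e s', (B ^+ e)%:P * s = s' \Po (A%:P + 'X * B%:P) /\ size s' = size s.
Proof.
move=> B0; have sz2 : size (A%:P + 'X * B%:P) = 2.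
  by rewrite addrC mulrC size_MXaddC polyC_eq0 (negbTE B0) size_polyC B0.
suff [e [s' E]] : exists e s', (B ^+ e)%:P * s = s' \Po (A%:P + 'X * B%:P).
  exists e, s'; split=> //; rewrite -(size_comp_poly2 _ sz2) -E size_Cmul //.
  by rewrite expf_neq0.
elim/poly_ind: s => [|s c [e [s' E]]].
  by exists 0, 0; rewrite mulr0 comp_poly0.
exists e.+1, (s' * ('X - A%:P) + (B ^+ e.+1 * c)%:P).
rewrite comp_polyD comp_polyM comp_polyB comp_polyX !comp_polyC addrAC subrr add0r.
rewrite -E mulrDr -rmorphM /= exprSr rmorphM /=; congr (_ + _).
by rewrite -!mulrA; congr (_ * _); rewrite mulrCA; congr (_ * _); rewrite mulrC.
Qed.

Lemma comp_affine_inj A B : B != 0 ->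
  injective (fun s : {poly {poly K}} => s \Po (A%:P + 'X * B%:P)).
Proof.
move=> B0 s1 s2 /eqP; rewrite -subr_eq0 -comp_polyB => /eqP E.
have sz2 : size (A%:P + 'X * B%:P) = 2 by rewrite addrC mulrC size_MXaddC polyC_eq0 (negbTE B0) size_polyC B0.
by apply/eqP; rewrite -subr_eq0 -size_poly_eq0 -(size_comp_poly2 _ sz2) E size_poly0.
Qed.

Section Irreducible.
Variables (F : {poly {poly k}}) (A : {poly K}) (x0 : K) (d e : nat).
Variable H1 : {poly {poly K}}.
Let B := ('X - x0%:P) ^+ e.
Let W := ('X - x0%:P) ^+ d.
Hypothesis irF : irr_monic F.
Hypothesis EH : subst (polyC \o iota) F (pencil A B) = map_poly polyC W * H1.
Hypothesis H1x0 : H1.[x0%:P] != 0.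

Let B0 : B != 0. Proof. by rewrite expf_neq0 // polyXsubC_eq0. Qed.
Let W0 : W != 0. Proof. by rewrite expf_neq0 // polyXsubC_eq0. Qed.

Let swapEH : map_poly (map_poly iota) F \Po (A%:P + 'X * B%:P) = W%:P * swapXY H1.
Proof. by rewrite -swap_subst_pencil EH rmorphM /= swapXY_map_polyC. Qed.

(** A factor constant in u divides the leading coefficient in u of F(t, A + u B), which is B^r with
    r = deg_x F because F is monic. Up to a constant it is thus a power of t - x0, and [H1x0] leaves
    only the power 0. *)
Let trivial_factor g h : H1 = g * h -> size (swapXY g) = 1 -> size g = 1.
Proof.
move=> E /eqP sg; have [gam gam0 Eg] := size_poly1P _ sg.
have {}Eg : g = map_poly polyC gam by rewrite -swapXY_polyC -Eg swapXYK.
have gx0 : gam.[x0] != 0.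
  apply: contra H1x0 => /eqP g0.
  by rewrite E hornerM Eg horner_map g0 mul0r.
have gW : gam %| B ^+ (size F).-1.
  have := congr1 lead_coef swapEH; rewrite E rmorphM /= Eg swapXY_map_polyC.
  rewrite !lead_coefM !lead_coefC lead_coef_comp; last first.
    by rewrite addrC mulrC size_MXaddC polyC_eq0 (negbTE B0) size_polyC B0.
  have -> : lead_coef (A%:P + 'X * B%:P) = B.
    rewrite addrC lead_coefDl ?lead_coefM ?lead_coefX ?lead_coefC ?mul1r //.
    by rewrite mulrC size_Cmul // size_polyX ltnS size_polyC_leq1.
  have mFK : map_poly (map_poly iota) F \is monic by apply: monic_map (irF.1).
  rewrite (monicP mFK) mul1r size_map_inj_poly ?rmorph0 //; last exact: map_poly_inj.
  by move=> ->; rewrite mulrCA dvdp_mulr.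
rewrite /B -exprM in gW; have [l _ El] := dvdp_exp_XsubCP gW.
case: l El => [|l] El; last first.
  case/negP: gx0; rewrite -rootE (eqp_root El) rootE horner_exp !hornerE subrr.
  by rewrite expr0n.
by rewrite Eg size_map_inj_poly ?polyC0 //; [rewrite (eqp_size El) size_poly1 | apply: polyC_inj].
Qed.

(** The factors of H1 turn into factors of F times a power of B in K[t][x]. [gauss_lemma] removes
    that power, and absolute irreducibility makes one factor constant in x, hence in u;
    [trivial_factor] concludes. *)
Lemma pencil_factor g h : H1 = g * h -> size g = 1 \/ size h = 1.
Proof.
move=> E.
have [e1 [g' [Eg sg]]] := homogenize A (swapXY g) B0.
have [e2 [h' [Eh sh]]] := homogenize A (swapXY h) B0.
have E' : (B ^+ e1 * B ^+ e2)%:P * map_poly (map_poly iota) F = (W%:P * g') * h'.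
  apply: (comp_affine_inj (A := A) B0); rewrite /= !comp_polyM !comp_polyC swapEH.
  by rewrite -Eg -Eh E [swapXY _]rmorphM [(_ * _)%:P]rmorphM /=; ring.
have FK0 : map_poly (map_poly iota) F != 0.
  by apply: monic_neq0; apply: monic_map (irF.1).
have Be0 : B ^+ e1 * B ^+ e2 != 0 by rewrite mulf_neq0 // expf_neq0.
have [G [H [EF sG sH]]] := gauss_lemma Be0 FK0 E'.
have [s1|s1] := absolutely_irreducible irF EF.
  left; apply: (trivial_factor E); rewrite -sg.
  by rewrite -s1 sG size_Cmul.
right; apply: (@trivial_factor h g); first by rewrite mulrC.
by rewrite -sh -sH.
Qed.

Lemma pencil_irreducible (M : fieldType) (tau : {rmorphism {poly K} -> M}) :
  fraction_field tau -> (1 < size H1)%N -> irreducible_poly (map_poly tau H1).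
Proof.
move=> tauP s1; have szm := size_map_fraction tauP.
split; first by rewrite szm.
move=> q q1 /dvdpP[q' Eq].
have [c [g [c0 Eg]]] := clear_denominators tauP q'.
have [c' [h [c'0 Eh]]] := clear_denominators tauP q.
have E : (c * c')%:P * H1 = g * h.
  apply: (map_inj_poly tauP.1 (rmorph0 _)).
  by rewrite !rmorphM /= Eg Eh Eq !map_polyC /= -!mul_polyC; ring.
have H10 : H1 != 0 by rewrite -size_poly_gt0 ltnW.
have cc0 : c * c' != 0 by rewrite mulf_neq0.
have [g' [h' [E' sg sh]]] := gauss_lemma cc0 H10 E.
have sq : size q = size h' by rewrite sh -szm Eh size_scale // (fraction_eq0 tauP).
have sq' : size q' = size g' by rewrite sg -szm Eg size_scale // (fraction_eq0 tauP).
have [g1|h1] := pencil_factor E'; last by rewrite sq h1 in q1.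
rewrite -dvdp_size_eqp ?Eq ?dvdp_mull // size_mul ?sq' ?g1 //.
  by rewrite -size_poly_gt0 sq' g1.
by apply: contraNneq H10 => q0; rewrite -size_poly_eq0 -szm Eq q0 mulr0 size_poly0.
Qed.
End Irreducible.
End Pencil.

(** * Resultants and substitution *)

Section Bezout.
Variable k : closedFieldType.
Implicit Types F G : {poly {poly k}}.

Lemma closed_root_in (R : idomainType) (j : {rmorphism k -> R}) (p : {poly k}) z :
  p != 0 -> root (map_poly j p) z -> exists c, z = j c.
Proof.
have [r ->] := closed_field_poly_normal p; rewrite scaler_eq0 negb_or lead_coef_eq0.
case/andP=> p0 _; have j0 : j (lead_coef p) != 0 by rewrite fmorph_eq0 lead_coef_eq0.
rewrite map_polyZ rootZ //.
rewrite rmorph_prod /= (eq_bigr (fun c => 'X - (j c)%:P)); last first.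
  by move=> c _; rewrite map_polyXsubC.
rewrite -(big_map j xpredT (fun c => 'X - c%:P)) root_prod_XsubC => /mapP[c _ ->].
by exists c.
Qed.

(** For G of positive x-degree, d is the resultant in x. If it vanished, the common factor would be
    F up to factors from k[t], and division by the monic F would show that F divides G. *)
Lemma bezout_irr F G : irr_monic F -> ~ (exists Q, G = Q * F) ->
  exists (d : {poly k}) u v, d != 0 /\ d%:P = u * F + v * G.
Proof.
case=> mF irF nFG.
have F0 : F != 0 := monic_neq0 mF.
have sF : (1 < size F)%N.
  rewrite ltnNge; apply/negP => sF; apply: nFG; exists G.
  have /monicP := mF; rewrite (size1_polyC sF) lead_coefC => ->; by rewrite mulr1.
have [sG|sG] := ltnP 1 (size G); last first.
  exists G`_0, 0, 1; rewrite mul0r add0r mul1r -size1_polyC //; split=> //.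
  apply: contra_notN nFG => /eqP G0; exists 0.
  by rewrite mul0r (size1_polyC sG) G0.
have [uv _ Euv] := resultant_in_ideal sF sG.
exists (resultant F G), uv.1, uv.2; split=> //; rewrite resultant_eq0.
apply: contra_notN nFG => sD.
have /Pdiv.WeakIdomain.dvdpP[[c Q] /= c0 EF] := dvdp_gcdl F G.
have /Pdiv.WeakIdomain.dvdpP[[c' S] /= c'0 EG] := dvdp_gcdr F G.
set D := gcdp F G in sD EF EG.
have [Q' [D' [EF' sQ' sD']]] := gauss_lemma c0 F0 (etrans (mul_polyC _ _) EF).
have : size Q = 1.
  by case: (irF _ _ EF') => [<- //|]; rewrite sD' => s1; rewrite s1 in sD.
move/eqP => /size_poly1P[a a0 EQ]; rewrite {}EQ in EF.
have E : (a * c')%:P * G = (c%:P * S) * F.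
  have EF1 : c%:P * F = a%:P * D by rewrite [LHS]mul_polyC EF.
  have EG1 : c'%:P * G = S * D by rewrite [LHS]mul_polyC EG.
  by rewrite polyCM -mulrA EG1 [c%:P * S]mulrC -[RHS]mulrA EF1; ring.
have EGd := Pdiv.RingMonic.rdivp_eq mF G.
exists (Pdiv.Ring.rdivp G F); rewrite {1}EGd.
suff -> : Pdiv.Ring.rmodp G F = 0 by rewrite addr0.
apply/eqP; apply: contraT => r0.
have Er : (a * c')%:P * Pdiv.Ring.rmodp G F = (c%:P * S - (a * c')%:P * Pdiv.Ring.rdivp G F) * F.
  by rewrite mulrBl -E {2}EGd; ring.
have ac0 : a * c' != 0 by rewrite mulf_neq0.
have := congr1 (fun p : {poly _} => size p) Er; rewrite /= size_Cmul //.
have : (size (Pdiv.Ring.rmodp G F) < size F)%N by rewrite Pdiv.Ring.ltn_rmodp.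
have [->|T0] := eqVneq (c%:P * S - (a * c')%:P * Pdiv.Ring.rdivp G F) 0.
  by rewrite mul0r size_poly0 => _ /eqP; rewrite size_poly_eq0 (negbTE r0).
rewrite size_Mmonic // => lt Es; move: lt; rewrite Es.
move: T0; rewrite -size_poly_gt0; move: (size _) (size F) => x y /= *; lia.
Qed.

Lemma ring_irr_monic F : F \is monic -> ring_irreducible F -> irr_monic F.
Proof.
move=> mF [_ _ irF]; split=> // g h /irF.
by rewrite !poly_unitE => -[/andP[/eqP -> _]|/andP[/eqP -> _]]; [left|right].
Qed.

Lemma irr_monic_ndvd F G : irr_monic F -> irr_monic G -> (1 < size F)%N ->
  F != G -> ~ (exists Q, G = Q * F).
Proof.
move=> [mF _] [mG irG] sF neq [Q E].
case: (irG _ _ E) => [/eqP|sF']; last by rewrite sF' in sF.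
case/size_poly1P => c c0 EQ; case/eqP: neq; move: E; rewrite EQ => E.
have := congr1 lead_coef E; rewrite lead_coefM lead_coefC (monicP mF) (monicP mG) mulr1.
by move=> c1; rewrite E -c1 mul1r.
Qed.

Lemma small_ndvd F G : F \is monic -> G != 0 -> (size G < size F)%N ->
  ~ (exists Q, G = Q * F).
Proof.
move=> mF G0 lt [Q E]; move: lt; rewrite E size_Mmonic //; last first.
  by apply: contraNneq G0 => Q0; rewrite E Q0 mul0r.
have : (0 < size Q)%N.
  by rewrite size_poly_gt0; apply: contraNneq G0 => Q0; rewrite E Q0 mul0r.
by move: (size Q) (size F) => x y /= *; lia.
Qed.
End Bezout.

(** * Substitution: Taylor expansion, chain rule and degree in t *)

Section Substitution.
Variables (k : closedFieldType).
Implicit Types (F : {poly {poly k}}).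

Lemma taylor2 (R : comNzRingType) (p : {poly R}) (x h : R) :
  exists r, p.[x + h] = p.[x] + p^`().[x] * h + r * h ^+ 2.
Proof.
elim/poly_ind: p => [|p c [r E]]; first by exists 0; rewrite deriv0 !horner0 !mul0r !addr0.
exists (r * (x + h) + p^`().[x]).
by rewrite derivMXaddC !(hornerMXaddC, hornerD, hornerMX) E; ring.
Qed.

Section Ring.
Variables (R : comNzRingType) (j : {rmorphism k -> R}).

Lemma substD F G (g : {poly R}) : subst j (F + G) g = subst j F g + subst j G g.
Proof. by rewrite /subst rmorphD hornerD. Qed.
Lemma substM F G (g : {poly R}) : subst j (F * G) g = subst j F g * subst j G g.
Proof. by rewrite /subst rmorphM hornerM. Qed.
Lemma substC (c : {poly k}) (g : {poly R}) : subst j c%:P g = map_poly j c.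
Proof. by rewrite /subst map_polyC hornerC. Qed.
Lemma substX (g : {poly R}) : subst j 'X g = g.
Proof. by rewrite /subst map_polyX hornerX. Qed.

Lemma subst_taylor F (g h : {poly R}) : exists r,
  subst j F (g + h) = subst j F g + subst j F^`() g * h + r * h ^+ 2.
Proof.
have [r E] := taylor2 (map_poly (map_poly j) F) g h.
by exists r; rewrite /subst E deriv_map.
Qed.

(** Chain rule in t: [map_poly (@deriv k) F] is F_t, while the derivative in the outer variable is
    F_x. *)
Lemma deriv_subst F (g : {poly R}) :
  (subst j F g)^`() = subst j (map_poly (@deriv k) F) g + subst j F^`() g * g^`().
Proof.
elim/poly_ind: F => [|F c IH].
  by rewrite deriv0 map_poly0 /subst rmorph0 horner0 deriv0 mul0r addr0.
rewrite substD substM substX substC !derivE IH deriv_map.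
rewrite substD substM substX.
have -> : map_poly (@deriv k) (F * 'X + c%:P) = map_poly (@deriv k) F * 'X + (c^`())%:P.
  apply/polyP => i; rewrite coefD coef_map_id0 ?deriv0 // !(coefD, coefMX, coefC).
  by rewrite derivD; case: i => [|i]; rewrite /= ?deriv0 ?addr0 ?coef_map_id0 ?deriv0.
by rewrite substD substM substX substC; ring.
Qed.

Lemma horner_subst F (g : {poly R}) y :
  (subst j F g).[y] = (map_poly (map_poly j) F).[g.[y], y].
Proof.
rewrite /subst; elim/poly_ind: (map_poly _ F) => [|p c IH]; first by rewrite !horner0.
by rewrite !hornerE IH.
Qed.

Lemma map_subst (R' : comNzRingType) (f : {rmorphism R -> R'}) F g :
  map_poly f (subst j F g) = subst (f \o j) F (map_poly f g).
Proof.
rewrite /subst -horner_map -map_poly_comp; congr (_.[_]); apply: eq_map_poly => c /=.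
by rewrite map_poly_comp.
Qed.
End Ring.

Lemma eq_subst (R : comNzRingType) (j j' : {rmorphism k -> R}) F g :
  j =1 j' -> subst j F g = subst j' F g.
Proof.
by move=> E; rewrite /subst; congr (_.[_]); apply: eq_map_poly => c; apply: eq_map_poly.
Qed.

Lemma coef_mul_top (R : comNzRingType) (p q : {poly R}) a b :
  (size p <= a.+1)%N -> (size q <= b.+1)%N ->
  (size (p * q)%R <= (a + b).+1)%N /\ (p * q)`_(a + b) = p`_a * q`_b.
Proof.
move=> sp sq; split.
  by apply: leq_trans (size_polyMleq _ _) _; move: (size p) (size q) sp sq => x y; lia.
have lt : (a < (a + b).+1)%N by rewrite ltnS leq_addr.
rewrite coefM (bigD1 (Ordinal lt)) //= addKn big1 ?addr0 // => i ni.
have [lti|lei] := ltnP i a.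
  rewrite [X in _ * X]nth_default ?mulr0 //; apply: leq_trans sq _.
  by have := ltn_ord i; lia.
rewrite nth_default ?mul0r //; apply: leq_trans sp _.
by rewrite ltn_neqAle lei andbT eq_sym.
Qed.

Lemma coef_exp_top (R : comNzRingType) (g : {poly R}) n i : (size g <= n.+1)%N ->
  (size (g ^+ i)%R <= (i * n).+1)%N /\ (g ^+ i)`_(i * n) = g`_n ^+ i.
Proof.
move=> sg; elim: i => [|i [si ci]]; first by rewrite !expr0 size_poly1 coef1.
rewrite !exprS mulSn; have [-> ->] := coef_mul_top sg si.
by rewrite ci.
Qed.

(** By the slope bound each term c_i g^i has degree at most (r - i) n + i n = r n in t. The
    coefficient of t^(r n) is therefore a polynomial [l] in g_n, where l_i is the coefficient of
    t^((r - i) n) in c_i; in particular l_r = 1. *)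
Lemma subst_top F n : F \is monic -> (0 < (size F).-1)%N -> sl_le F n ->
  exists2 l : {poly k}, l != 0 &
  forall (R : comNzRingType) (j : {rmorphism k -> R}) (g : {poly R}), (size g <= n.+1)%N ->
  (size (subst j F g) <= ((size F).-1 * n).+1)%N /\
  (subst j F g)`_((size F).-1 * n) = (map_poly j l).[g`_n].
Proof.
move=> mF r0 slF; set r := (size F).-1.
have szF : size F = r.+1 by rewrite /r; case: (size F) r0.
have Fr : F`_r = 1 by have /monicP := mF; rewrite lead_coefE.
pose l := \poly_(i < r.+1) F`_i`_((r - i) * n).
have szc i : (i <= r)%N -> (size (F`_i)%R <= ((r - i) * n).+1)%N.
  rewrite leq_eqVlt => /orP[/eqP ->|lt]; first by rewrite Fr size_poly1.
  have := slF (r - i)%N; rewrite -/r subn_gt0 lt leq_subr subKn ?(ltnW lt) //= => H.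
  have [->|c0] := eqVneq F`_i 0; first by rewrite size_poly0.
  by have := H isT isT c0; rewrite mulnC; case: (size _).
exists l.
  suff : l`_r != 0 by apply: contraNneq => ->; rewrite coef0.
  by rewrite coef_poly ltnSn subnn mul0n Fr coef1 oner_eq0.
move=> R j g sg.
have E : subst j F g = \sum_(i < r.+1) map_poly j F`_i * g ^+ i.
  rewrite /subst (@horner_coef_wide _ r.+1); last first.
    by rewrite -szF size_poly.
  by apply: eq_bigr => i _; rewrite coef_map.
have T (i : 'I_r.+1) : (size (map_poly j F`_i * g ^+ i)%R <= (r * n).+1)%N /\
    (map_poly j F`_i * g ^+ i)`_(r * n) = j F`_i`_((r - i) * n) * g`_n ^+ i.
  have lei : (i <= r)%N by rewrite -ltnS.
  have [sgi cgi] := coef_exp_top i sg.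
  have sFi : (size (map_poly j F`_i)%R <= ((r - i) * n).+1)%N.
    by apply: leq_trans (size_poly _ _) (szc _ lei).
  by have := coef_mul_top sFi sgi; rewrite -mulnDl subnK // cgi coef_map.
split.
  rewrite E; apply: leq_trans (size_sum _ _ _) _; apply/bigmax_leqP => i _.
  by case: (T i).
rewrite E coef_sum (@horner_coef_wide _ r.+1); last first.
  by apply: leq_trans (size_poly _ _) (size_poly _ _).
apply: eq_bigr => i _; rewrite (T i).2 coef_map coef_poly ltn_ord //.
Qed.

End Substitution.

(** * Lifting embeddings and Galois orbits *)

Definition splits (K : fieldType) (p : {poly K}) :=
  exists rs, p %= \prod_(x <- rs) ('X - x%:P).

(** Adjoin a root z of an irreducible factor, divide by X - z and continue over the larger field. *)
Lemma splitting_extension (M : fieldType) (p : {poly M}) : p != 0 ->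
  exists (Lam : fieldType) (j : {rmorphism M -> Lam}), splits (map_poly j p).
Proof.
move: (leqnn (size p)); move: {2}(size p) => m.
elim: m M p => [|m IH] M p szp p0.
  by move: szp; rewrite leqn0 size_poly_eq0 (negbTE p0).
have [s1|] := leqP (size p) 1.
  exists M, idfun, [::]; rewrite big_nil map_poly_id // -size_poly_eq1.
  by rewrite eqn_leq s1 size_poly_gt0.
case/irreducible_factor => r irr rp.
have [L _ [z rz _]] := irredp_FAdjoin irr.
have : root (map_poly (in_alg L) p) z.
  by rewrite -(divpK rp) rmorphM rootM rz orbT.
case/factor_theorem => q Eq.
have q0 : q != 0.
  apply: contraNneq p0 => q0.
  by rewrite -(map_poly_eq0 (in_alg L)) Eq q0 mul0r.
have szq : (size q <= m)%N.
  have := size_map_poly (in_alg L) p; rewrite Eq size_Mmonic ?monicXsubC //.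
  by rewrite size_XsubC addn2 /= => E; rewrite -E in szp.
have [Lam [j [rs Ers]]] := IH _ q szq q0.
exists Lam, (j \o in_alg L), (j z :: rs).
rewrite map_poly_comp Eq rmorphM /= map_polyXsubC big_cons mulrC.
by rewrite eqp_mul2l ?polyXsubC_eq0.
Qed.

Section Lift.
Variables (K : fieldType) (L : fieldExtType K) (Lam : fieldType).

Lemma lift_step (E : {subfield L}) (psi : {rmorphism subvs_of E -> Lam}) x
    (q : {poly subvs_of E}) y : map_poly vsval q = minPoly E x ->
    root (map_poly psi q) y ->
  exists psi' : {rmorphism subvs_of <<E; x>>%AS -> Lam},
    forall a : K, psi' a%:A = psi a%:A.
Proof.
move=> Eq rq; pose Q z := map_poly (vsproj E) (Fadjoin_poly E x z).
pose f (z : subvs_of <<E; x>>%AS) := (map_poly psi (Q (vsval z))).[y].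
have QE z : map_poly vsval (Q z) = Fadjoin_poly E x z.
  have [s Es] := polyOver_subvs (Fadjoin_polyOver E x z).
  rewrite /Q Es; congr (map_poly vsval _).
  by rewrite -map_poly_comp map_poly_id // => w _ /=; rewrite vsvalK.
(* The value of f at z does not depend on the polynomial representing z: two of them differ by a
   multiple of q, whose image vanishes at y. Additivity and multiplicativity follow. *)
have fE z (s : {poly subvs_of E}) : (map_poly vsval s).[x] = vsval z ->
    f z = (map_poly psi s).[y].
  move=> sz; suff : q %| Q (vsval z) - s.
    case/dvdpP => w /eqP; rewrite subr_eq => /eqP Ew; rewrite /f Ew.
    by rewrite rmorphD rmorphM /= hornerD hornerM (rootP rq) mulr0 add0r.
  rewrite -(dvdp_map (vsval : {rmorphism subvs_of E -> L})) /= Eq rmorphB /= QE.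
  apply: minPoly_dvdp; last first.
    by rewrite rootE hornerD hornerN sz Fadjoin_poly_eq ?subrr ?subvsP.
  by rewrite rpredB ?Fadjoin_polyOver //; apply/polyOver_subvs; exists s.
have QV z : (map_poly vsval (Q (vsval z))).[x] = vsval (z : subvs_of <<E; x>>%AS).
  by rewrite QE Fadjoin_poly_eq ?subvsP.
have fB : zmod_morphism f.
  move=> a b; rewrite (fE (a - b) (Q (vsval a) - Q (vsval b))).
    by rewrite rmorphB /= hornerD hornerN.
  by rewrite rmorphB /= hornerD hornerN !QV.
have fM : monoid_morphism f.
  split=> [|a b].
    by rewrite (fE 1 1%:P) map_polyC hornerC /= ?rmorph1 ?algid1.
  rewrite (fE (a * b) (Q (vsval a) * Q (vsval b))).
    by rewrite rmorphM /= hornerM.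
  by rewrite rmorphM /= hornerM !QV.
pose fA := GRing.isZmodMorphism.Build _ _ f fB.
pose fMM := GRing.isMonoidMorphism.Build _ _ f fM.
pose fR : {rmorphism subvs_of <<E; x>>%AS -> Lam} := HB.pack f fA fMM.
exists fR => a; rewrite /= (fE _ a%:A%:P).
  by rewrite map_polyC hornerC.
by rewrite map_polyC hornerC /= !algid1.
Qed.

(** The minimal polynomial over E of a root of p divides p, so its image divides a split polynomial
    and has a root in [Lam], to which [lift_step] sends the new generator. *)
Lemma lift_seq (p : {poly K}) (phi : {rmorphism K -> Lam}) rs :
    splits (map_poly phi p) -> all (root (map_poly (in_alg L) p)) rs ->
  forall (E : {subfield L}) (psi : {rmorphism subvs_of E -> Lam}),
    (forall a : K, psi a%:A = phi a) ->
  exists psi' : {rmorphism subvs_of <<E & rs>>%AS -> Lam},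
    forall a : K, psi' a%:A = phi a.
Proof.
case=> ys Eys; elim: rs => [|x rs IH] /= rrs E psi psiE.
  have -> : <<E & [::]>>%AS = E by apply: val_inj; rewrite /= Fadjoin_nil.
  by exists psi.
case/andP: rrs => rx rrs.
have [q Eq] := polyOver_subvs (minPolyOver E x).
have qp : q %| map_poly (in_alg (subvs_of E)) p.
  rewrite -(dvdp_map (vsval : {rmorphism subvs_of E -> L})) /= -Eq -map_poly_comp.
  have -> : map_poly (vsval \o in_alg (subvs_of E)) p = map_poly (in_alg L) p.
    by apply: eq_map_poly => a; rewrite /= algid1.
  by apply: minPoly_dvdp => //; apply/polyOverP => i; rewrite coef_map /= memvZ ?mem1v.
have : map_poly psi q %| \prod_(y <- ys) ('X - y%:P).
  rewrite -(eqp_dvdr _ Eys).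
  have -> : map_poly phi p = map_poly psi (map_poly (in_alg (subvs_of E)) p).
    by rewrite -map_poly_comp; apply: eq_map_poly => a; rewrite /= psiE.
  by rewrite dvdp_map.
case/dvdp_prod_XsubC => mk Emk.
have [y ry] : exists y, root (map_poly psi q) y.
  have := eqp_size Emk; rewrite size_prod_XsubC size_map_poly.
  rewrite -(size_map_poly (vsval : {rmorphism subvs_of E -> L})) -Eq size_minPoly.
  case E' : (mask mk ys) => [|y s] //= sz.
  by exists y; rewrite (eqp_root Emk) E' root_prod_XsubC mem_head.
have [psi1 Epsi1] := lift_step (esym Eq) ry.
have [|psi' Epsi'] := IH rrs <<E; x>>%AS psi1.
  by move=> a; rewrite Epsi1.
have E' : <<E & x :: rs>>%AS = << <<E; x>> & rs>>%AS.
  by apply: val_inj; rewrite /= adjoin_cons.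
by rewrite E'; exists psi'.
Qed.

Lemma lift_embedding (p : {poly K}) (phi : {rmorphism K -> Lam}) :
    splittingFieldFor 1%VS (map_poly (in_alg L) p) fullv ->
    splits (map_poly phi p) ->
  exists Phi : {rmorphism L -> Lam}, forall a : K, Phi a%:A = phi a.
Proof.
case=> rs Ers Efull spl.
(* The lifting starts from the copy of K in L, formed by the scalars [a%:A]. *)
have ex1 (z : subvs_of (1%AS : {subfield L})) : exists a : K, a%:A == vsval z.
  by have /vlineP[a ->] := subvsP z; exists a.
pose f z := phi (xchoose (ex1 z)).
have fE z a : a%:A = vsval z -> f z = phi a.
  move=> Ea; congr (phi _); apply: (fmorph_inj (in_alg L)); rewrite /= Ea.
  exact/eqP/(xchooseP (ex1 z)).
have fV z : (xchoose (ex1 z))%:A = vsval z by apply/eqP/(xchooseP (ex1 z)).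
have fB : zmod_morphism f.
  move=> a b; rewrite (fE _ (xchoose (ex1 a) - xchoose (ex1 b))) ?rmorphB //.
  by rewrite scalerBl !fV.
have fM : monoid_morphism f.
  split=> [|a b]; first by rewrite (fE _ 1) ?rmorph1 //= scale1r ?algid1.
  rewrite (fE _ (xchoose (ex1 a) * xchoose (ex1 b))) ?rmorphM //.
  by rewrite -[_%:A]/(in_alg L _) rmorphM /= !fV.
pose fA := GRing.isZmodMorphism.Build _ _ f fB.
pose fMM := GRing.isMonoidMorphism.Build _ _ f fM.
pose fR : {rmorphism subvs_of (1%AS : {subfield L}) -> Lam} := HB.pack f fA fMM.
have allr : all (root (map_poly (in_alg L) p)) rs.
  by apply/allP => x xrs; rewrite (eqp_root Ers) root_prod_XsubC.
have [|psi Epsi] := lift_seq spl allr (psi := fR).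
  by move=> a; rewrite /= (fE _ a) //= algid1.
have mem (z : L) : z \in <<1 & rs>>%AS by rewrite /= Efull memvf.
pose g (z : L) := psi (Subvs (mem z)).
have gB : zmod_morphism g.
  by move=> a b; rewrite /g -rmorphB; congr (psi _); apply: val_inj.
have gM : monoid_morphism g.
  split=> [|a b]; first by rewrite /g -(rmorph1 psi); congr (psi _); apply: val_inj; rewrite /= algid1.
  by rewrite /g -rmorphM; congr (psi _); apply: val_inj.
pose gA := GRing.isZmodMorphism.Build _ _ g gB.
pose gMM := GRing.isMonoidMorphism.Build _ _ g gM.
pose gR : {rmorphism L -> Lam} := HB.pack g gA gMM.
exists gR => a; rewrite /= /g -Epsi; congr (psi _); apply: val_inj.
by rewrite /= algid1.
Qed.
End Lift.

(** * Galois orbits from irreducible polynomials over a larger field *)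

Section Orbit.
Variables (K : fieldType) (L : splittingFieldType K) (M Lam : fieldType).
Variables (phi : {rmorphism K -> M}) (j : {rmorphism M -> Lam}) (Phi : {rmorphism L -> Lam}).
Hypothesis PhiE : forall a : K, Phi a%:A = j (phi a).

Lemma rational_adjoin (xs : seq L) : (forall x, x \in xs -> exists w, Phi x = j w) ->
  forall z, z \in <<1 & xs>>%VS -> exists w, Phi z = j w.
Proof.
elim/last_ind: xs => [|xs x IH] okx z.
  by rewrite Fadjoin_nil => /vlineP[a ->]; exists (phi a); apply: PhiE.
rewrite adjoin_rcons => /Fadjoin_polyP[p pE ->].
have [|w Ew] := okx x; first by rewrite mem_rcons mem_head.
have okE u : u \in <<1 & xs>>%VS -> exists w, Phi u = j w.
  by apply: IH => v vxs; apply: okx; rewrite mem_rcons inE vxs orbT.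
rewrite horner_coef; apply: (big_ind (fun u => exists w, Phi u = j w)).
- by exists 0; rewrite !rmorph0.
- by move=> a b [wa Ea] [wb Eb]; exists (wa + wb); rewrite !rmorphD Ea Eb.
move=> i _; have [wi Ei] := okE _ (polyOverP pE i).
by exists (wi * w ^+ i); rewrite !rmorphM !rmorphXn /= Ei Ew.
Qed.

(** The minimal polynomial of x over E = K(xs) has its coefficients in M after [Phi]. It shares the
    root Phi x with the irreducible Q, so Q divides it; hence y is one of its roots, that is, a
    conjugate of x over E. *)
Lemma gal_orbit (xs : seq L) (Q : {poly M}) x y :
    (forall z, z \in xs -> exists w, Phi z = j w) -> irreducible_poly Q ->
    root (map_poly j Q) (Phi x) -> root (map_poly j Q) (Phi y) ->
  exists g, [/\ g \in ('Gal({:L} / 1%VS))%g, g x = y & forall z, z \in xs -> g z = z].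
Proof.
move=> okxs irrQ Qx Qy; pose E : {subfield L} := <<1 & xs>>%AS.
have okE (i : nat) : exists w, Phi (minPoly E x)`_i == j w.
  have [w Ew] := rational_adjoin okxs (polyOverP (minPolyOver E x) i).
  by exists w; rewrite Ew.
pose mu := \poly_(i < size (minPoly E x)) xchoose (okE i).
have Emu : map_poly j mu = map_poly Phi (minPoly E x).
  apply/polyP => i; rewrite !coef_map coef_poly /=.
  case: ltnP => [_|le]; first exact/esym/eqP/(xchooseP (okE i)).
  by rewrite nth_default // !rmorph0.
have mux : root (map_poly j mu) (Phi x) by rewrite Emu fmorph_root root_minPoly.
have Qmu : Q %| mu.
  have [g1|g1] := eqVneq (size (gcdp Q mu)) 1.
    have : coprimep (map_poly j Q) (map_poly j mu) by rewrite coprimep_map /coprimep g1.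
    by move/coprimep_root => /(_ _ Qx) ; rewrite -rootE mux.
  by rewrite -(eqp_dvdl _ (irrQ.2 _ g1 (dvdp_gcdl _ _))) dvdp_gcdr.
have muy : root (minPoly E x) y.
  rewrite -(fmorph_root Phi) -Emu; move: Qy; rewrite -!dvdp_XsubCl => /dvdp_trans; apply.
  by rewrite dvdp_map.
have [g gE gx] := normalField_root_minPoly (subvf E) (normalFieldf E) (memvf x) muy.
exists g; split=> // [|z zxs].
  by move: gE; apply/subsetP/galS; apply: sub1v.
by apply: (fixed_gal (subvf E) gE); apply: seqv_sub_adjoin.
Qed.
End Orbit.

(* Correct the images of the elements of r one after the other. *)
Lemma gal_all_perms (K : fieldType) (L : splittingFieldType K) (m : nat) (P : 'I_m -> pred L)
    (r : seq L) (s : 'I_m -> L -> L) :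
  (forall i x, P i x -> x \in r) ->
  (forall i j x, P i x -> P j x -> i = j) ->
  (forall i g x, g \in ('Gal({:L} / 1%VS))%g -> P i x -> P i (g x)) ->
  (forall i x y, P i x -> P i y -> x != y -> exists2 g, g \in ('Gal({:L} / 1%VS))%g &
     [/\ g x = y & forall j z, P j z -> z != x -> z != y -> g z = z]) ->
  (forall i, {in P i &, injective (s i)} /\ (forall x, P i x -> P i (s i x))) ->
  exists2 g, g \in ('Gal({:L} / 1%VS))%g & forall i x, P i x -> g x = s i x.
Proof.
move=> Pr disj stab trans sP.
suff [g gG gs] : exists2 g, g \in ('Gal({:L} / 1%VS))%g &
    forall i x, x \in r -> P i x -> g x = s i x.
  by exists g => // i x Pix; apply: gs => //; apply: Pr Pix.
move: {Pr} r => r; elim: r => [|x r [g gG gs]].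
  by exists 1%g; rewrite ?group1.
have [[i Pix]|nP] := pselect (exists i, P i x); last first.
  exists g => // i y; rewrite inE => /orP[/eqP -> Pix|]; last exact: gs.
  by case: nP; exists i.
have [E|ne] := eqVneq (g x) (s i x).
  exists g => // i' y; rewrite inE => /orP[/eqP -> Pi'x|]; last exact: gs.
  by rewrite -(disj i i' x).
have [inj sst] := sP i.
have [h hG [hgx hz]] := trans i _ _ (stab i g x gG Pix) (sst _ Pix) ne.
have [xr|xr] := boolP (x \in r); first by rewrite (gs i x) ?eqxx in ne.
exists (g * h)%g; first by rewrite groupM.
move=> i' y; rewrite inE => /orP[/eqP ->|yr] Pi'y.
  by rewrite galM ?memvf // hgx (disj i i' x).
(* h moves no root other than g x and s_i x. The image g y of a root treated earlier differs from g
   x because g is injective, and from s_i x because g y = s_i' y and s_i is injective. *)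
rewrite galM ?memvf // -(gs i' y) //; apply: (hz i'); first exact: stab.
  by rewrite (inj_eq (fmorph_inj _)); apply: contraNneq xr => <-.
apply: contraNneq xr; rewrite (gs i' y) // => E.
have ii' : i = i'.
  by apply: (disj _ _ (s i x)); [apply: sst | rewrite -E; apply: (sP i').2].
by rewrite -(inj y x) //; [rewrite -topredE /= ii' | rewrite [in LHS]ii'].
Qed.

(** * Power series *)

Definition series (K : fieldType) : Type := nat -> K.

Section SeriesRing.
Variable K : fieldType.
Local Notation series := (series K).
Implicit Types a b c : series.

HB.instance Definition _ := gen_eqMixin series.
HB.instance Definition _ := gen_choiceMixin series.

Definition series_add a b : series := fun n => a n + b n.
Definition series_opp a : series := fun n => - a n.
Definition series_zero : series := fun=> 0.
Definition series_mul a b : series := fun n => \sum_(i < n.+1) a i * b (n - i)%N.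
Definition series_one : series := fun n => (n == 0)%:R.

Fact series_addA : associative series_add.
Proof. by move=> a b c; apply: funext => n; apply: addrA. Qed.
Fact series_addC : commutative series_add.
Proof. by move=> a b; apply: funext => n; apply: addrC. Qed.
Fact series_add0 : left_id series_zero series_add.
Proof. by move=> a; apply: funext => n; apply: add0r. Qed.
Fact series_addN : left_inverse series_zero series_opp series_add.
Proof. by move=> a; apply: funext => n; apply: addNr. Qed.

HB.instance Definition _ :=
  GRing.isZmodule.Build series series_addA series_addC series_add0 series_addN.

(** Reduction modulo s^(n + 1). The coefficient of index n of a product depends only on the
    truncations, so the ring axioms are inherited from polynomials. *)
Definition trunc n a : {poly K} := \poly_(i < n.+1) a i.

Lemma coef_truncM n m a b : (n <= m)%N -> (trunc m a * trunc m b)`_n = series_mul a b n.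
Proof.
move=> nm; rewrite coefM; apply: eq_bigr => i _; rewrite !coef_poly.
by rewrite !ltnS (leq_trans (leq_subr _ _) nm) (leq_trans _ nm) // -ltnS.
Qed.

Fact series_mulC : commutative series_mul.
Proof. by move=> a b; apply: funext => n; rewrite -!(coef_truncM _ _ (leqnn n)) mulrC. Qed.

Fact series_mulA : associative series_mul.
Proof.
move=> a b c; apply: funext => n; rewrite -!(coef_truncM _ _ (leqnn n)).
transitivity (trunc n a * (trunc n b * trunc n c))`_n.
  rewrite !coefM; apply: eq_bigr => i _; congr (_ * _).
  by rewrite coef_poly ltnS leq_subr coef_truncM // leq_subr.
rewrite mulrA !coefM; apply: eq_bigr => i _; congr (_ * _).
by rewrite coef_poly ltn_ord coef_truncM // -ltnS.
Qed.

Fact series_mul1 : left_id series_one series_mul.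
Proof.
move=> a; apply: funext => n; rewrite /series_mul big_ord_recl /= mul1r subn0.
by rewrite big1 ?addr0 // => i _; rewrite mul0r.
Qed.

Fact series_mulD : left_distributive series_mul series_add.
Proof.
move=> a b c; apply: funext => n; rewrite /series_mul /series_add -big_split /=.
by apply: eq_bigr => i _; rewrite mulrDl.
Qed.

Fact series_one_neq0 : series_one != 0.
Proof.
apply/eqP => /(congr1 (fun a : series => a 0)) /eqP.
by rewrite /series_one eqxx oner_eq0.
Qed.

HB.instance Definition _ := GRing.Zmodule_isComNzRing.Build series
  series_mulA series_mulC series_mul1 series_mulD series_one_neq0.

Definition of_poly (p : {poly K}) : series := fun n => p`_n.
Definition residue a : K := a 0.

Fact of_poly_zmod : zmod_morphism of_poly.
Proof. by move=> p q; apply: funext => n; rewrite /of_poly coefB. Qed.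
Fact of_poly_monoid : monoid_morphism of_poly.
Proof.
split; first by apply: funext => n; rewrite /of_poly coef1.
by move=> p q; apply: funext => n; rewrite /of_poly coefM.
Qed.
HB.instance Definition _ := GRing.isZmodMorphism.Build _ _ of_poly of_poly_zmod.
HB.instance Definition _ := GRing.isMonoidMorphism.Build _ _ of_poly of_poly_monoid.

Fact residue_zmod : zmod_morphism residue. Proof. by []. Qed.
Fact residue_monoid : monoid_morphism residue.
Proof. by split=> // a b; rewrite /residue [LHS]big_ord_recl big_ord0 addr0. Qed.
HB.instance Definition _ := GRing.isZmodMorphism.Build _ _ residue residue_zmod.
HB.instance Definition _ := GRing.isMonoidMorphism.Build _ _ residue residue_monoid.

Lemma of_poly_inj : injective of_poly.
Proof. by move=> p q E; apply/polyP => n; apply: (congr1 (fun a : series => a n) E). Qed.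

Lemma residue_of_poly p : residue (of_poly p) = p.[0].
Proof. by rewrite horner_coef0. Qed.

Definition uniformizer : series := of_poly 'X.
Local Notation s := uniformizer.

Lemma residue_uniformizer : residue s = 0.
Proof. by rewrite residue_of_poly hornerX. Qed.

Lemma coef_expsM n b i : (s ^+ n * b : series) i = if (i < n)%N then 0 else b (i - n)%N.
Proof.
rewrite /uniformizer -rmorphXn /= -[LHS](coef_truncM _ _ (leqnn i)) coefM.
case: ltnP => [lt|le].
  rewrite big1 // => j _; rewrite coef_poly ltn_ord /of_poly coefXn.
  by rewrite ltn_eqF ?mul0r //; apply: leq_trans lt; rewrite ltnS -ltnS.
have lt : (n < i.+1)%N by [].
rewrite (bigD1 (Ordinal lt)) //= !coef_poly lt ltnS leq_subr /of_poly.
rewrite coefXn eqxx mul1r big1 ?addr0 // => j nj.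
rewrite coef_poly ltn_ord coefXn -val_eqE /= in nj *.
by rewrite (negbTE nj) mul0r.
Qed.

Lemma exps_dvdP n a : (forall i, (i < n)%N -> a i = 0) -> exists b, a = s ^+ n * b.
Proof.
move=> a0; exists (fun i => a (i + n)%N); apply: funext => i.
by rewrite coef_expsM; case: ltnP => [/a0|/subnK ->].
Qed.

Lemma residue_eq0P a : residue a = 0 -> exists b, a = s * b.
Proof.
by move=> a0; have [[]//|b ->] := @exps_dvdP 1 a; exists b; rewrite expr1.
Qed.

Lemma series_factor a : a != 0 -> exists n b, a = s ^+ n * b /\ residue b != 0.
Proof.
move=> a0; have ex : exists n, a n != 0.
  apply: contrapT => H; case/eqP: a0; apply: funext => n.
  by apply/eqP/negPn/negP => an; apply: H; exists n.
case: (ex_minnP ex) => n an minn.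
have [|b Eb] := @exps_dvdP n a.
  by move=> i lt; apply/eqP/negPn/negP => /minn; rewrite leqNgt lt.
by exists n, b; split=> //; move: an; rewrite Eb coef_expsM ltnn subnn.
Qed.

(** Newton iteration with the fixed slope [e], inverse to p' at x modulo s: each step gains a factor
    s, because 1 - p'(y_n) e is divisible by s. *)
Lemma hensel (p : {poly series}) (x : K) :
    (map_poly residue p).[x] = 0 -> (map_poly residue p)^`().[x] != 0 ->
  exists y, p.[y] = 0 /\ residue y = x.
Proof.
move=> px0 px1; pose e := of_poly ((map_poly residue p)^`().[x]^-1)%:P.
have re : residue e * (map_poly residue p)^`().[x] = 1.
  by rewrite residue_of_poly hornerC mulVf.
pose y n : series := iter n (fun y => y - p.[y] * e) (of_poly x%:P).
have yP n : residue (y n) = x /\ exists b, p.[y n] = s ^+ n.+1 * b.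
  elim: n => [|n [ry [b Eb]]].
    split; first by rewrite residue_of_poly hornerC.
    suff /residue_eq0P[b ->] : residue p.[y 0] = 0 by exists b; rewrite expr1.
    by rewrite -horner_map /= residue_of_poly hornerC.
  rewrite /= -/(y n); split.
    by rewrite rmorphB rmorphM /= Eb exprS !rmorphM /= residue_uniformizer !mul0r subr0.
  have [r ->] := taylor2 p (y n) (- (p.[y n] * e)).
  have [c Ec] : exists c, 1 - p^`().[y n] * e = s * c.
    apply: residue_eq0P; rewrite rmorphB rmorphM rmorph1 /= -horner_map /= ry.
    by rewrite -deriv_map mulrC re subrr.
  exists (b * c + r * e ^+ 2 * b ^+ 2 * s ^+ n).
  transitivity (p.[y n] * (1 - p^`().[y n] * e) + r * (p.[y n] * e) ^+ 2); first by ring.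
  by rewrite Ec Eb !exprS; ring.
have yS n i : (i <= n)%N -> y n.+1 i = y n i.
  move=> le; have [_ [b Eb]] := yP n.
  have : y n.+1 - y n = s ^+ n.+1 * (- (b * e)).
    by rewrite /= -/(y n) Eb; ring.
  move/(congr1 (fun a : series => a i)); rewrite coef_expsM ltnS le => /eqP.
  by rewrite subr_eq0 => /eqP.
have yD n i : (i <= n)%N -> y n i = y i i.
  elim: n => [|n IH]; first by rewrite leqn0 => /eqP ->.
  rewrite leq_eqVlt => /orP[/eqP -> //|]; rewrite ltnS => le.
  by rewrite yS ?IH.
(* The coefficient of index i no longer changes from step i on, so the diagonal is the limit. *)
pose z : series := fun i => y i i.
have zy n : exists b, z = y n + s ^+ n.+1 * b.
  have [|b Eb] := @exps_dvdP n.+1 (z - y n).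
    by move=> i; rewrite ltnS => le; apply/eqP; rewrite subr_eq0 yD.
  by exists b; rewrite -Eb addrC subrK.
exists z; split; last by rewrite /residue /z; have [<- _] := yP 0.
apply: funext => n; have [b ->] := zy n; have [_ [c Ec]] := yP n.
have [r ->] := taylor2 p (y n) (s ^+ n.+1 * b).
have -> : p.[y n] + p^`().[y n] * (s ^+ n.+1 * b) + r * (s ^+ n.+1 * b) ^+ 2 =
    s ^+ n.+1 * (c + p^`().[y n] * b + r * b ^+ 2 * s ^+ n.+1) by rewrite Ec; ring.
by rewrite coef_expsM ltnSn.
Qed.

(** Hensel's lemma applied to a X - 1. *)
Lemma series_invertible a : residue a != 0 -> exists b, b * a = 1.
Proof.
move=> a0; have := @hensel (a%:P * 'X - 1%:P) (residue a)^-1.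
rewrite rmorphB rmorphM /= map_polyX !map_polyC /= rmorph1.
rewrite !derivE !hornerE /= divff // subrr => -[//||b [Eb _]].
  by rewrite subr0.
by exists b; move/eqP: Eb; rewrite !hornerE subr_eq0 mulrC => /eqP.
Qed.

Lemma series_invertible_ex a : exists b, residue a != 0 -> b * a = 1.
Proof.
have [/series_invertible[b Eb]|a0] := boolP (residue a != 0); first by exists b.
by exists 0.
Qed.

Definition series_unit : pred series := fun a => residue a != 0.
Definition series_inv a : series :=
  if residue a != 0 then sval (cid (series_invertible_ex a)) else a.

Fact series_mulV : {in series_unit, left_inverse 1 series_inv *%R}.
Proof. by move=> a ua; rewrite /series_inv; case: cid => b /= /(_ ua); rewrite ifT. Qed.
Fact series_unitP a b : b * a = 1 -> series_unit a.
Proof.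
move/(congr1 residue); rewrite rmorphM rmorph1 /= => E.
by apply/negP => /eqP ra; move: E; rewrite ra mulr0 => /eqP; rewrite eq_sym oner_eq0.
Qed.
Fact series_inv_out : {in [predC series_unit], series_inv =1 id}.
Proof. by move=> a /negbTE ua; rewrite /series_inv ifF. Qed.

HB.instance Definition _ := GRing.ComNzRing_hasMulInverse.Build series
  series_mulV series_unitP series_inv_out.

Fact series_integral : GRing.integral_domain_axiom series.
Proof.
move=> a b E; apply/norP => -[a0 b0].
have [n [a' [Ea ra]]] := series_factor a0; have [m [b' [Eb rb]]] := series_factor b0.
have : s ^+ (n + m) * (a' * b') = 0 by rewrite exprD mulrACA -Ea -Eb E.
move/(congr1 (fun c : series => c (n + m)%N)); rewrite coef_expsM ltnn subnn.
rewrite -[LHS]/(residue (a' * b')) rmorphM => /eqP.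
by rewrite mulf_eq0 (negbTE ra) (negbTE rb).
Qed.
HB.instance Definition _ := GRing.ComUnitRing_isIntegral.Build series series_integral.

Lemma series_unitE a : (a \is a GRing.unit) = (residue a != 0). Proof. by []. Qed.

Lemma uniformizer_neq0 : s != 0.
Proof.
by rewrite -(rmorph0 of_poly) (inj_eq of_poly_inj) polyX_eq0.
Qed.

(** The elements of [rs] are distinct and are not roots of [t], so each is a simple root of the
    reduction; the lifted roots are split off one at a time. *)
Lemma hensel_split (rs : seq K) (p : {poly series}) (t : {poly K}) :
    map_poly residue p = t * \prod_(x <- rs) ('X - x%:P) -> uniq rs ->
    (forall x, x \in rs -> t.[x] != 0) ->
  exists (ys : seq series) q, [/\ map residue ys = rs,
    p = q * \prod_(y <- ys) ('X - y%:P) & map_poly residue q = t].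
Proof.
elim: rs p => [|x rs IH] p.
  by rewrite big_nil mulr1; exists [::], p; rewrite big_nil mulr1.
rewrite big_cons => Ep /= /andP[xrs urs] tP.
pose t' := t * \prod_(x <- rs) ('X - x%:P).
have Ep' : map_poly residue p = t' * ('X - x%:P) by rewrite Ep /t'; ring.
have t'x : t'.[x] != 0.
  rewrite hornerM mulf_neq0 ?tP ?mem_head // -[_ == 0]/(root _ x).
  by rewrite root_prod_XsubC.
have [||y [py ry]] := @hensel p x.
- by rewrite Ep' hornerM hornerXsubC subrr mulr0.
- by rewrite Ep' derivM derivXsubC mulr1 hornerD hornerM hornerXsubC subrr mulr0 add0r.
have /factor_theorem[p1 Ep1] : root p y by apply/eqP.
have Er1 : map_poly residue p1 = t'.
  apply: (@mulIf _ ('X - x%:P)); first by rewrite polyXsubC_eq0.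
  by move: Ep'; rewrite Ep1 rmorphM /= map_polyXsubC /= ry.
have [|ys [q [Eys Eq Et]]] := IH p1 Er1 urs.
  by move=> z zrs; apply: tP; rewrite inE zrs orbT.
exists (y :: ys), q; split=> //=; first by rewrite ry Eys.
by rewrite Ep1 Eq big_cons; ring.
Qed.

(** The size condition makes the leading coefficient a unit, and power series are integrally closed.
    Otherwise x = a' / c with a' a unit and c divisible by s; multiplying the equation by c^N and
    reducing modulo s would leave only the leading term, which is nonzero. *)
Lemma series_integral_root (M : fieldType) (tau : {rmorphism series -> M}) (p : {poly series}) x :
    fraction_field tau -> size (map_poly residue p) = size p -> p != 0 ->
    root (map_poly tau p) x ->
  exists y, x = tau y.
Proof.
move=> tauP szp p0 rx; have [a [b [b0 Ex]]] := tauP.2 x.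
have tau0 c : (tau c == 0) = (c == 0) by apply: fraction_eq0.
have [a0|a0] := eqVneq a 0; first by exists 0; rewrite Ex a0 rmorph0 mul0r.
have [n [a' [Ea ra]]] := series_factor a0; have [m [b' [Eb rb]]] := series_factor b0.
have ub : b' \is a GRing.unit by rewrite series_unitE.
have b'0 : b' != 0 by apply: contraNneq rb => ->; rewrite rmorph0.
have s0 := uniformizer_neq0.
have [mn|nm] := leqP m n.
  exists (s ^+ (n - m) * a' / b').
  apply: (@mulIf _ (tau b)); first by rewrite tau0.
  rewrite Ex divfK ?tau0 // -rmorphM Ea Eb -{1}(subnK mn) exprD; congr (tau _).
  by rewrite [RHS]mulrCA -[_ / b' * b']mulrA mulVr // mulr1; ring.
pose c := s ^+ (m - n) * b'.
have Exc : x * tau c = tau a'.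
  apply: (@mulIf _ (tau (s ^+ n))); first by rewrite tau0 expf_neq0.
  rewrite -mulrA -!rmorphM Ex /c.
  have -> : s ^+ (m - n) * b' * s ^+ n = b by rewrite Eb -{2}(subnK (ltnW nm)) exprD; ring.
  by rewrite divfK ?tau0 // Ea mulrC.
have rc : residue c = 0.
  by rewrite /c rmorphM rmorphXn /= residue_uniformizer expr0n subn_eq0 leqNgt nm mul0r.
clearbody c; pose N := (size p).-1.
have szN : size p = N.+1 by rewrite /N prednK // size_poly_gt0.
have E : \sum_(i < N.+1) p`_i * a' ^+ i * c ^+ (N - i) = 0.
  apply/eqP; rewrite -tau0 rmorph_sum /=.
  suff -> : \sum_(i < N.+1) tau (p`_i * a' ^+ i * c ^+ (N - i)) = (map_poly tau p).[x] * tau c ^+ N.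
    by rewrite (rootP rx) mul0r.
  rewrite (@horner_coef_wide _ N.+1); last by rewrite -szN size_poly.
  rewrite mulr_suml; apply: eq_bigr => i _.
  rewrite !rmorphM !rmorphXn /= coef_map /= -Exc.
  have le : (i <= N)%N by rewrite -ltnS.
  have -> : tau c ^+ N = tau c ^+ i * tau c ^+ (N - i) by rewrite -exprD subnKC.
  by rewrite exprMn; ring.
have := congr1 residue E; rewrite rmorph0 big_ord_recr rmorphD rmorph_sum /= big1.
  rewrite add0r subnn mulr1 rmorphM rmorphXn /= => /eqP.
  rewrite mulf_eq0 expf_eq0 (negbTE ra) andbF orbF => /eqP r0.
  have : lead_coef (map_poly residue p) != 0.
    by rewrite lead_coef_eq0 -size_poly_eq0 szp szN.
  by rewrite lead_coefE szp coef_map /= r0 eqxx.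
move=> i _; rewrite rmorphM /= (rmorphXn residue) /= rc expr0n subn_eq0.
by rewrite leqNgt ltn_ord mulr0.
Qed.
End SeriesRing.

(** * Generic polynomials *)

Lemma fraction_extend (R : idomainType) (K M : fieldType) (tau : {rmorphism R -> K})
    (f : {rmorphism R -> M}) : fraction_field tau -> injective f ->
  exists phi : {rmorphism K -> M}, forall a, phi (tau a) = f a.
Proof.
move=> tauP finj.
have tau0 a : (tau a == 0) = (a == 0) by apply: fraction_eq0.
have f0 a : (f a == 0) = (a == 0) by rewrite -(rmorph0 f) (inj_eq finj).
have ex x : exists ab, ab.2 != 0 /\ x = tau ab.1 / tau ab.2.
  by have [a [b H]] := tauP.2 x; exists (a, b).
pose ab x := sval (cid (ex x)).
have ab0 x : (ab x).2 != 0 by rewrite /ab; case: cid => y [].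
have abE x : x = tau (ab x).1 / tau (ab x).2 by rewrite /ab; case: cid => y [].
pose phi x := f (ab x).1 / f (ab x).2.
have phiE x a b : b != 0 -> x = tau a / tau b -> phi x = f a / f b.
  move=> b0 Ex; have := abE x; rewrite {1}Ex /phi => /eqP.
  rewrite eqr_div ?tau0 // -!rmorphM (inj_eq tauP.1) => /eqP E.
  by apply/eqP; rewrite eqr_div ?f0 // -!rmorphM E.
have phiB : zmod_morphism phi.
  move=> x y; rewrite (phiE _ ((ab x).1 * (ab y).2 - (ab y).1 * (ab x).2) ((ab x).2 * (ab y).2)).
  - by rewrite /phi rmorphB !rmorphM /=; field; rewrite !f0 !ab0.
  - by rewrite mulf_neq0.
  by rewrite {1}(abE x) {1}(abE y) rmorphB !rmorphM /=; field; rewrite !tau0 !ab0.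
have phiM : monoid_morphism phi.
  split=> [|x y]; first by rewrite (phiE _ 1 1) ?oner_neq0 // !rmorph1 divr1.
  rewrite (phiE _ ((ab x).1 * (ab y).1) ((ab x).2 * (ab y).2)).
  - by rewrite /phi !rmorphM /=; field; rewrite !f0 !ab0.
  - by rewrite mulf_neq0.
  by rewrite {1}(abE x) {1}(abE y) !rmorphM /=; field; rewrite !tau0 !ab0.
pose A := GRing.isZmodMorphism.Build _ _ phi phiB.
pose B := GRing.isMonoidMorphism.Build _ _ phi phiM.
pose phiR : {rmorphism K -> M} := HB.pack phi A B.
exists phiR => a; rewrite /= (phiE _ a 1) ?oner_neq0 // ?rmorph1 ?divr1 //.
Qed.

Section Evaluation.
Variable k : idomainType.

Fixpoint mconst_morph n : {rmorphism k -> mpoly k n} :=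
  match n return {rmorphism k -> mpoly k n} with
  | 0 => idfun
  | m.+1 => (polyC \o mconst_morph m : {rmorphism k -> {poly mpoly k m}})
  end.

Lemma mconst_morphE n c : mconst_morph n c = mconst n c.
Proof. by elim: n => //= n ->. Qed.

Section Eval.
Variables (R : comNzRingType) (j : {rmorphism k -> R}) (alpha : nat -> R).

Fixpoint meval n : {rmorphism mpoly k n -> R} :=
  match n return {rmorphism mpoly k n -> R} with
  | 0 => j
  | m.+1 => (horner_morph (fun x => mulrC (alpha m) (meval m x)) : {rmorphism {poly mpoly k m} -> R})
  end.

Lemma meval_const n c : meval n (mconst n c) = j c.
Proof. by elim: n => //= n IH; rewrite horner_morphC. Qed.

Lemma meval_var n i : (i < n)%N -> meval n (mvar k n i) = alpha i.
Proof.
elim: n => //= n IH; rewrite ltnS leq_eqVlt; case: eqVneq => [-> _|_ /= /IH <-].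
  by rewrite horner_morphX.
by rewrite horner_morphC.
Qed.
End Eval.

Lemma meval_unique (R : comNzRingType) n (rho1 rho2 : {rmorphism mpoly k n -> R}) :
    (forall c, rho1 (mconst n c) = rho2 (mconst n c)) ->
    (forall i, (i < n)%N -> rho1 (mvar k n i) = rho2 (mvar k n i)) ->
  rho1 =1 rho2.
Proof.
elim: n rho1 rho2 => [|n IH] rho1 rho2 Ec Ev; first exact: Ec.
pose r1 : {rmorphism {poly mpoly k n} -> R} := rho1.
pose r2 : {rmorphism {poly mpoly k n} -> R} := rho2.
have EC a : r1 a%:P = r2 a%:P.
  apply: (IH (r1 \o polyC) (r2 \o polyC)) => [c|i lt]; first exact: Ec.
  have := Ev i (ltnW lt); rewrite /= ltn_eqF //.
have EX : r1 'X = r2 'X by have := Ev n (ltnSn n); rewrite /= eqxx.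
move=> p; rewrite -[LHS]/(r1 p) -[RHS]/(r2 p); elim/poly_ind: p => [|p c E].
  by rewrite !rmorph0.
by rewrite !rmorphD !rmorphM EX E EC.
Qed.
End Evaluation.

Section Generic.
Variables (k : closedFieldType) (n : nat).
Local Notation K := (ratfun k n.+1).

Definition ratconst : {rmorphism k -> K} :=
  (@FracField.tofrac (mpoly k n.+1) : {rmorphism _ -> {fraction mpoly k n.+1}}) \o mconst_morph k n.+1.

Lemma subst_fE F : subst_f n F = subst ratconst F (generic_f k n).
Proof.
rewrite /subst_f /subst; congr (_.[_]); apply: eq_map_poly => c; apply: eq_map_poly => a.
by rewrite /= /rconst -mconst_morphE.
Qed.

Lemma coef_generic_f i : (generic_f k n)`_i = if (i < n.+1)%N then rvar k n.+1 i else 0.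
Proof.
rewrite /generic_f coef_sum; case: ltnP => lt.
  rewrite (bigD1 (Ordinal lt)) //= coefCM coefXn eqxx mulr1 big1 ?addr0 // => j nj.
  rewrite coefCM coefXn -val_eqE /= in nj *.
  by rewrite eq_sym (negbTE nj) mulr0.
rewrite big1 // => j _; rewrite coefCM coefXn gtn_eqF ?mulr0 //.
exact: leq_trans (ltn_ord j) lt.
Qed.

Lemma size_generic_f : (size (generic_f k n) <= n.+1)%N.
Proof. by apply/leq_sizeP => i le; rewrite coef_generic_f ltnNge le. Qed.

Variable L : fieldExtType K.

Definition const_in : {rmorphism k -> L} := in_alg L \o ratconst.
Definition generic_in : {poly L} := map_poly (in_alg L) (generic_f k n).

Lemma size_generic_in : (size generic_in <= n.+1)%N.
Proof. by rewrite size_map_poly size_generic_f. Qed.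

Lemma subst_f_in F : map_poly (in_alg L) (subst_f n F) = subst const_in F generic_in.
Proof. by rewrite subst_fE map_subst. Qed.

Definition embed : {rmorphism mpoly k n.+1 -> L} :=
  in_alg L \o (@FracField.tofrac (mpoly k n.+1) : {rmorphism _ -> {fraction mpoly k n.+1}}).

Lemma embed_inj : injective embed.
Proof. by move=> x y /fmorph_inj /tofrac_inj. Qed.

Lemma embed_const c : embed (mconst n.+1 c) = const_in c.
Proof. by rewrite -mconst_morphE. Qed.

Lemma embed_var i : (i < n.+1)%N -> embed (mvar k n.+1 i) = generic_in`_i.
Proof. by move=> lt; rewrite coef_map coef_generic_f lt. Qed.

(** Evaluating a_i at the coefficients of g is injective on k[a], since following it by [rho] gives
    the inclusion into L composed with [jL]. It therefore extends to the fraction field k(a). *)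
Lemma generic_embedding (R : idomainType) (j : {rmorphism k -> R}) (g : {poly R})
    (M N : fieldType) (tau : {rmorphism R -> M}) (rho : {rmorphism R -> N})
    (jL : {rmorphism L -> N}) :
    injective tau -> (size g <= n.+1)%N -> map_poly rho g = map_poly jL generic_in ->
    (forall c, rho (j c) = jL (const_in c)) ->
  exists phi : {rmorphism K -> M},
    forall F, map_poly phi (subst_f n F) = map_poly tau (subst j F g).
Proof.
move=> tauinj sg Eg Ej; pose f0 := meval j (fun i => g`_i) n.+1.
have E : rho \o f0 =1 jL \o embed.
  apply: meval_unique => [c|i lt]; first by
    exact: etrans (congr1 rho (meval_const _ _ _ _))
             (etrans (Ej c) (congr1 jL (esym (embed_const _)))).
  apply: etrans (congr1 rho (meval_var _ _ lt)) _.
  by rewrite -coef_map Eg coef_map -embed_var.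
have finj : injective (tau \o f0).
  move=> x y /tauinj /(congr1 rho); rewrite -[LHS]/((rho \o f0) x) -[RHS]/((rho \o f0) y).
  by rewrite !E => /fmorph_inj /embed_inj.
have [phi phiE] := fraction_extend (tofrac_fraction_field (mpoly k n.+1)) finj.
exists phi => F; rewrite subst_fE !map_subst.
have -> : map_poly phi (generic_f k n) = map_poly tau g.
  apply/polyP => i; rewrite !coef_map coef_generic_f; case: ltnP => [lt|le].
    exact: etrans (phiE _) (congr1 tau (meval_var _ _ lt)).
  have -> : g`_i = 0 by rewrite nth_default // (leq_trans sg).
  exact: etrans (rmorph0 phi) (esym (rmorph0 tau)).
apply: eq_subst => c; apply: etrans (phiE _) (congr1 tau _).
by rewrite mconst_morphE; apply: meval_const.
Qed.

(** A constant takes the same value at all points [alpha]; two points with different values thus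
    show that an element of k[a] is not constant. *)
Lemma embed_in_const P c (alpha : nat -> k) :
  embed P = const_in c -> meval idfun alpha n.+1 P = c.
Proof. by rewrite -embed_const => /embed_inj ->; rewrite meval_const. Qed.

Lemma generic_coef_nconst i c : (i < n.+1)%N -> generic_in`_i <> const_in c.
Proof.
move=> lt; rewrite -embed_var // => E.
have := embed_in_const (fun=> 1) E; rewrite meval_var // => E1.
have := embed_in_const (fun=> 0) E; rewrite meval_var // -E1 => /eqP.
by rewrite eq_sym oner_eq0.
Qed.

Lemma generic_value_nconst x c : generic_in.[const_in x] <> const_in c.
Proof.
pose P : mpoly k n.+1 := \sum_(i < n.+1) mvar k n.+1 i * mconst_morph k n.+1 x ^+ i.
have EP : embed P = generic_in.[const_in x].
  rewrite (@horner_coef_wide _ n.+1) ?size_generic_in // rmorph_sum; apply: eq_bigr => i _.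
  by rewrite rmorphM rmorphXn mconst_morphE embed_const embed_var.
(* At a_0 = e with all other a_i = 0 the generic polynomial is the constant e. *)
have mP e : meval idfun (fun i => if i == 0 then e else 0) n.+1 P = e.
  rewrite rmorph_sum big_ord_recl rmorphM rmorphXn expr0 mulr1 meval_var // big1 ?addr0 //.
  by move=> i _; rewrite rmorphM meval_var ?mul0r // ltn_ord.
rewrite -EP => E; have := embed_in_const (fun i => if i == 0 then 1 else 0) E.
rewrite mP => E1; have := embed_in_const (fun i => if i == 0 then 0 else 0) E.
by rewrite mP -E1 => /eqP; rewrite eq_sym oner_eq0.
Qed.
End Generic.

(** * Tangent pencils *)

Lemma irreducible_separable (M : fieldType) (q : {poly M}) :
  irreducible_poly q -> q^`() != 0 -> separable_poly q.
Proof.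
move=> irq q'0; rewrite unlock /coprimep.
have [//|g1] := eqVneq (size (gcdp q q^`())) 1.
have := irq.2 _ g1 (dvdp_gcdl _ _) => /eqp_dvdl Eq.
have : q %| q^`() by rewrite -Eq dvdp_gcdr.
move/(dvdp_leq q'0); have q0 : q != 0 := irredp_neq0 irq.
by rewrite leqNgt lt_size_deriv.
Qed.

Section Tangent.
Variables (k : closedFieldType) (K : fieldType) (iota : {rmorphism k -> K}).
Variables (F : {poly {poly k}}) (x0 : K).
Implicit Types (A Y : {poly K}).

Lemma pencil0 A B : map_poly (horner_eval 0) (pencil A B) = A.
Proof.
rewrite rmorphD rmorphM /= map_polyC /= horner_evalE hornerX mul0r addr0.
by rewrite -map_poly_comp map_poly_id // => c _ /=; rewrite horner_evalE hornerC.
Qed.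

(* F(t, A + u B) = B (Y + u F_x(t, A) + u^2 B ...), so the cofactor of B at x0 has
   u-coefficient F_x(x0, A(x0)). *)
Lemma pencil_tangent A Y e : subst iota F A = ('X - x0%:P) ^+ e * Y ->
    (subst iota F^`() A).[x0] != 0 ->
  exists H1, subst (polyC \o iota) F (pencil A (('X - x0%:P) ^+ e)) =
    map_poly polyC (('X - x0%:P) ^+ e) * H1 /\ H1.[x0%:P] != 0.
Proof.
set B := _ ^+ e => EY Fx0; rewrite /pencil.
have [r ->] := subst_taylor (polyC \o iota) F (map_poly polyC A) ('X%:P * map_poly polyC B).
rewrite -!map_subst EY rmorphM /=.
exists (map_poly polyC Y + map_poly polyC (subst iota F^`() A) * 'X%:P
        + r * map_poly polyC B * 'X%:P * 'X%:P).
split; first by ring.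
apply: contraNneq Fx0 => /(congr1 (fun p : {poly K} => p`_1)).
rewrite !hornerD !hornerM !hornerC !horner_map /= !coefD coef0 coefC add0r.
by rewrite !coefMX /= coefC addr0 => ->.
Qed.

(* If the derivative in t of the cofactor of (t - x0)^d in F(t, A + u (t - x0)^2) vanishes, then
   eliminating u through x = A + u (t - x0)^2 gives the polynomial identity
   tangency d A = 0 in t and x. *)
Definition tangency d A : {poly {poly K}} :=
  let FK := map_poly (map_poly iota) in
  ('X - x0%:P)%:P * FK (map_poly (@deriv k) F)
  + FK F^`() * (('X - x0%:P) * A^`() - 2%:R *: A)%:P + FK F^`() * 'X *+ 2 - FK F *+ d.

Lemma inseparable_tangency A d H1 :
    subst (polyC \o iota) F (pencil A (('X - x0%:P) ^+ 2)) =
      map_poly polyC (('X - x0%:P) ^+ d) * H1 -> H1^`() = 0 ->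
  tangency d A = 0.
Proof.
move=> EH H1'; have B0 : ('X - x0%:P) ^+ 2 != 0 by rewrite expf_neq0 // polyXsubC_eq0.
apply: (comp_affine_inj (A := A) B0); rewrite /= comp_poly0 -swap_horner_pencil.
suff -> : (map_poly (map_poly polyC) (tangency d A)).[pencil A (('X - x0%:P) ^+ 2)] = 0.
  by rewrite rmorph0.
rewrite /tangency !(rmorphB (map_poly (map_poly _)), rmorphD (map_poly (map_poly _)),
  rmorphM (map_poly (map_poly _)), rmorphMn (map_poly (map_poly _))) /= !map_polyC map_polyX /=.
rewrite !(hornerD, hornerN, hornerMn, hornerM, hornerC, hornerX) -!subst_polyC.
set g := pencil _ _ in EH *; set p := map_poly polyC ('X - x0%:P).
have p'1 : p^`() = 1 by rewrite /p map_polyXsubC derivXsubC.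
(* As H1' = 0, differentiation only meets the factor (t - x0)^d. *)
have E1 : p * (subst (polyC \o iota) F g)^`() = subst (polyC \o iota) F g *+ d.
  rewrite EH derivM H1' mulr0 addr0 rmorphXn /= -/p deriv_exp p'1 mul1r.
  case: d {EH} => [|d]; first by rewrite mulr0n mul0r mulr0.
  by rewrite /= exprS mulrnAl mulrnAr mulrA.
(* Elimination of u: the derivative of u (t - x0)^2 times t - x0 is 2 u (t - x0)^2 = 2 (g - A). *)
have E2 : p * g^`() = p * map_poly polyC A^`() + (g - map_poly polyC A) *+ 2.
  have EA : (map_poly polyC A)^`() = map_poly polyC A^`() by rewrite deriv_map.
  rewrite /g /pencil derivD derivM derivC rmorphXn -/p deriv_exp p'1 EA; ring.
have EC : map_poly polyC (('X - x0%:P) * A^`() - 2%:R *: A) =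
    p * map_poly polyC A^`() - map_poly polyC A *+ 2.
  by rewrite rmorphB rmorphM scaler_nat rmorphMn.
rewrite -E1 deriv_subst EC -/p [p * (_ + _)]mulrDr [p * (_ * g^`())]mulrCA E2; ring.
Qed.

(** The cubic enters with the factor 3 - 2 = 1, nonzero in every characteristic; a square would
    enter with 2 - 2 = 0. *)
Lemma tangencyD d A c : tangency d (A + c *: ('X - x0%:P) ^+ 3) =
  tangency d A + map_poly (map_poly iota) F^`() * (c *: ('X - x0%:P) ^+ 3)%:P.
Proof.
rewrite /tangency derivD derivZ deriv_exp derivXsubC mul1r /=.
set q := 'X - x0%:P; set FK' := map_poly _ F^`().
have -> : q * (A^`() + c *: (q ^+ 2 *+ 3)) - 2%:R *: (A + c *: q ^+ 3) =
    (q * A^`() - 2%:R *: A) + c *: q ^+ 3.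
  by rewrite -!mul_polyC; ring.
by rewrite [(_ + c *: _)%:P]rmorphD; ring.
Qed.

(** By [tangencyD] the expression is affine in c, with slope F_x (t - x0)^3, which is nonzero. *)
Lemma tangency_unique d A c c' : F^`() != 0 ->
  tangency d (A + c *: ('X - x0%:P) ^+ 3) = 0 ->
  tangency d (A + c' *: ('X - x0%:P) ^+ 3) = 0 -> c = c'.
Proof.
move=> F'0; rewrite !tangencyD => E E'.
have : map_poly (map_poly iota) F^`() * ((c - c') *: ('X - x0%:P) ^+ 3)%:P = 0.
  rewrite scalerBl rmorphB mulrBr; apply/eqP; rewrite subr_eq0; apply/eqP.
  by apply: (@addrI _ (tangency d A)); rewrite E E'.
move/eqP; rewrite mulf_eq0 polyC_eq0 scaler_eq0 expf_eq0 polyXsubC_eq0 /= orbF subr_eq0.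
have inj : injective (map_poly (map_poly iota)).
  by apply: map_inj_poly (rmorph0 _); apply: map_poly_inj.
by rewrite -(rmorph0 (map_poly (map_poly iota))) (inj_eq inj) (negbTE F'0) => /eqP.
Qed.
End Tangent.

(** * Double transitivity *)

Section GenericRoots.
Variables (k : closedFieldType) (n : nat) (L : splittingFieldType (ratfun k n.+1)).
Implicit Types F G : {poly {poly k}}.
Local Notation K := (ratfun k n.+1).
Local Notation iota := (const_in L).
Local Notation f := (generic_in L).

Definition admissible F :=
  [/\ irr_monic F, F^`() != 0, (0 < (size F).-1)%N & sl_le F n].

(** Otherwise f(c) would be a root of the monic polynomial F(c, x) over k, hence an element of k. *)
Lemma root_nconst F c : F \is monic -> ~ root (subst iota F f) (iota c).
Proof.
move=> mF; rewrite rootE horner_subst => r0.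
pose Fc := map_poly (horner_eval c) F.
have Fc0 : Fc != 0 by apply: monic_neq0; apply: monic_map.
have E : root (map_poly iota Fc) f.[iota c].
  rewrite rootE -[X in X == 0](_ : (map_poly (map_poly iota) F).[f.[iota c], iota c] = _).
    exact: r0.
  rewrite -[LHS]/(horner_eval (iota c) _) -horner_map /= horner_evalE hornerC.
  rewrite -!map_poly_comp; congr (_.[_]); apply: eq_map_poly => a /=.
  by rewrite !horner_evalE horner_map.
by have [d /generic_value_nconst] := closed_root_in Fc0 E.
Qed.

(** By [bezout_irr] a common root would be a root of a nonzero d in k[t], hence constant, against
    [root_nconst]. *)
Lemma cofactor_nonzero F G x : irr_monic F -> ~ (exists Q, G = Q * F) ->
  root (subst iota F f) x -> (subst iota G f).[x] != 0.
Proof.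
move=> irF nFG rx; have [d [u [v [d0 Ed]]]] := bezout_irr irF nFG.
apply: contraPneq (rx) => Gx; have dx : root (map_poly iota d) x.
  rewrite rootE -(substC iota d f) Ed substD !substM hornerD !hornerM.
  by rewrite (rootP rx) Gx !mulr0 addr0.
have [c ->] := closed_root_in d0 dx.
by apply: root_nconst irF.1.
Qed.

Lemma deriv_nonzero F x : admissible F -> root (subst iota F f) x ->
  (subst iota F^`() f).[x] != 0.
Proof.
case=> irF F'0 r0 _; apply: cofactor_nonzero => //; apply: small_ndvd irF.1 F'0 _.
by apply: lt_size_deriv; apply: monic_neq0 irF.1.
Qed.

(** The coefficient of top degree is l(g_n). After specialization g_n becomes a_n plus a constant,
    which is not in k, whereas the roots of l are. *)
Lemma size_subst_generic F (R : comNzRingType) (j : {rmorphism k -> R}) (g : {poly R})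
    (N : fieldType) (rho : {rmorphism R -> N}) (jL : {rmorphism L -> N}) c :
    admissible F -> (size g <= n.+1)%N -> rho g`_n = jL (f`_n + iota c) ->
    (forall a, rho (j a) = jL (iota a)) ->
  size (subst j F g) = ((size F).-1 * n).+1.
Proof.
case=> irF _ r0 slF sg Eg Ej; have [l l0 lP] := subst_top irF.1 r0 slF.
have [sle top] := lP R j g sg.
apply/eqP; rewrite eqn_leq sle /= ltnNge; apply/negP => le.
move: top; rewrite nth_default // => /(congr1 rho); rewrite rmorph0 -horner_map Eg.
have -> : map_poly rho (map_poly j l) = map_poly jL (map_poly iota l).
  by rewrite -!map_poly_comp; apply: eq_map_poly => a /=.
rewrite horner_map => /esym/eqP; rewrite fmorph_eq0 => /(closed_root_in l0)[d Ed].
have := @generic_coef_nconst k n L n (d - c) (ltnSn n); apply.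
by rewrite rmorphB -Ed addrK.
Qed.

Lemma size_subst_f F : admissible F -> size (subst_f n F) = ((size F).-1 * n).+1.
Proof.
move=> adF; rewrite -(size_map_poly (in_alg L)) subst_f_in.
apply: (@size_subst_generic _ _ _ _ L idfun idfun 0) => //; first exact: size_generic_in.
by rewrite rmorph0 addr0.
Qed.

Section Splitting.
Variable P : {poly K}.
Hypothesis splitP : splittingFieldFor 1%VS (map_poly (in_alg L) P) fullv.
Hypothesis P0 : P != 0.

Lemma subst_f_splits F : subst_f n F %| P -> splits (subst iota F f).
Proof.
rewrite -subst_f_in -(dvdp_map (in_alg L)) => FP.
have [rs Ers _] := splitP; rewrite (eqp_dvdr _ Ers) in FP.
by have [mk Emk] := dvdp_prod_XsubC FP; exists (mask mk rs).
Qed.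

(** M is the fraction field of L[u], and [phi] sends a to the coefficients of g = f + u (t - x0)^e,
    which specializes to f at u = 0. [Phi] extends it to L and carries the roots of F(t, f) to those
    of F(t, g). Here w is x0 viewed in M, and j w need not be Phi x0. *)
Lemma pencil_setup F x0 e Y : admissible F -> (e < n)%N ->
    root (subst iota F f) x0 -> subst iota F f = ('X - x0%:P) ^+ e * Y ->
    ((size F).-1 * n > e)%N ->
  exists (M Lam : fieldType) (phi : {rmorphism K -> M}) (j : {rmorphism M -> Lam})
      (Phi : {rmorphism L -> Lam}) (Q : {poly M}) (w : M),
    [/\ forall a : K, Phi a%:A = j (phi a), irreducible_poly Q &
        map_poly Phi (subst iota F f) = ('X - (j w)%:P) ^+ e * map_poly j Q].
Proof.
move=> adF en rx0 EY sz; have Fx0 := deriv_nonzero adF rx0.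
have [irF _ _ _] := adF.
have [H1 [EH H1x0]] := pencil_tangent EY Fx0.
set B := ('X - x0%:P) ^+ e in EH; set g := pencil f B in EH.
have szB : size B = e.+1 by rewrite /B size_exp_XsubC.
have sg : (size g <= n.+1)%N.
  rewrite /g /pencil; apply: leq_trans (size_polyD _ _) _; rewrite geq_max.
  rewrite size_map_polyC size_generic_in /= size_Cmul ?polyX_eq0 // size_map_polyC szB.
  exact: leq_trans en _.
have szH : size (subst (polyC \o iota) F g) = ((size F).-1 * n).+1.
  apply: (@size_subst_generic _ _ _ _ L (horner_eval 0) idfun 0) => //.
    by rewrite (rmorph0 iota) addr0 -coef_map pencil0.
  by move=> a; apply: hornerC.
have mB : map_poly polyC B \is monic by rewrite map_monic ?monic_exp ?monicXsubC //; apply: polyC_inj.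
have szH1 : (1 < size H1)%N.
  have H10 : H1 != 0 by apply: contraNneq H1x0 => ->; rewrite horner0.
  have := szH; rewrite EH size_monicM // size_map_polyC szB.
  by move: sz; case: (size H1) => [|[|s]] //=; rewrite ?addnS ?addn0 /=; lia.
have [M [tau tauP]] := fraction_field_exists {poly L}.
have irQ := pencil_irreducible irF EH H1x0 tauP szH1.
have [phi phiE] : exists phi : {rmorphism K -> M},
    forall F, map_poly phi (subst_f n F) = map_poly tau (subst (polyC \o iota) F g).
  apply: (@generic_embedding _ _ _ _ _ _ _ _ tau (horner_eval 0) idfun) => //.
  - exact: tauP.1.
  - by rewrite pencil0 map_poly_id.
  by move=> c; apply: hornerC.
have phiP0 : map_poly phi P != 0 by rewrite map_poly_eq0.
have [Lam [j spl]] := splitting_extension phiP0.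
have [Phi PhiE] : exists Phi : {rmorphism L -> Lam}, forall a : K, Phi a%:A = (j \o phi) a.
  by apply: lift_embedding splitP _; rewrite map_poly_comp.
exists M, Lam, phi, j, Phi, (map_poly tau H1), (tau x0%:P); split=> //.
rewrite -subst_f_in -map_poly_comp.
have -> : map_poly (Phi \o in_alg L) (subst_f n F) = map_poly j (map_poly phi (subst_f n F)).
  by rewrite -map_poly_comp; apply: eq_map_poly => a; apply: PhiE.
by rewrite phiE EH !rmorphM /= /B !rmorphXn /= !map_polyXsubC.
Qed.

Local Notation G := ('Gal({:L} / 1%VS))%g.

Lemma gal_root F g x : g \in G -> root (subst iota F f) x -> root (subst iota F f) (g x).
Proof.
move=> gG; rewrite -subst_f_in -(fmorph_root g) -map_poly_comp.
rewrite (_ : map_poly (g \o in_alg L) _ = map_poly (in_alg L) (subst_f n F)) //.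
apply: eq_map_poly => a; rewrite /= (fixed_gal (sub1v _) gG) //.
by rewrite memvZ ?mem1v.
Qed.

Hypothesis n3 : (3 <= n)%N.

Lemma size_gt2 F : admissible F -> ((size F).-1 * n > 2)%N.
Proof. by case=> _ _ r0 _; apply: leq_trans n3 _; rewrite leq_pmull. Qed.

Lemma exists_root F : admissible F -> subst_f n F %| P -> exists x, root (subst iota F f) x.
Proof.
move=> adF /subst_f_splits[rs Ers]; have := eqp_size Ers.
rewrite -{1}subst_f_in size_map_poly (size_subst_f adF) size_prod_XsubC => -[].
have := size_gt2 adF; case: rs Ers => [|x rs] Ers; first by move=> + E; rewrite E.
by exists x; rewrite (eqp_root Ers) root_prod_XsubC mem_head.
Qed.

Lemma gal_transitive F x y : admissible F -> subst_f n F %| P ->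
    root (subst iota F f) x -> root (subst iota F f) y ->
  exists2 g, g \in G & g x = y.
Proof.
move=> adF FP rx ry.
have [||M [Lam [phi [j [Phi [Q [w [PhiE irQ EQ]]]]]]]] :=
  @pencil_setup F x 0 (subst iota F f) adF (ltnW (ltnW n3)) rx.
- by rewrite expr0 mul1r.
- exact: ltnW (ltnW (size_gt2 adF)).
have rQ z : root (subst iota F f) z -> root (map_poly j Q) (Phi z).
  by rewrite -(fmorph_root Phi) EQ expr0 mul1r.
have [|g [gG gx _]] := @gal_orbit _ _ _ _ phi j Phi PhiE [::] Q x y _ irQ (rQ _ rx) (rQ _ ry).
  by [].
by exists g.
Qed.

(** The fixed root is the x with Phi x = j w, rather than x0 itself: its image is rational over M,
    so [gal_orbit] applies with [xs] reduced to x. *)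
Lemma gal_stab_transitive F : admissible F -> subst_f n F %| P ->
  exists2 x, root (subst iota F f) x & forall y z,
    root (subst iota F f) y -> root (subst iota F f) z -> y != x -> z != x ->
    exists g, [/\ g \in G, g x = x & g y = z].
Proof.
move=> adF FP; have [x0 rx0] := exists_root adF FP.
have /factor_theorem[Y EY] := rx0.
have [||M [Lam [phi [j [Phi [Q [w [PhiE irQ EQ]]]]]]]] :=
  @pencil_setup F x0 1 Y adF (ltnW n3) rx0.
- by rewrite expr1 mulrC.
- exact: ltnW (size_gt2 adF).
have [rs Ers] := subst_f_splits FP.
have : root (map_poly Phi (subst iota F f)) (j w).
  by rewrite EQ rootM expr1 root_XsubC eqxx.
have Ers' : map_poly Phi (subst iota F f) %= \prod_(x <- map Phi rs) ('X - x%:P).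
  have := Ers; rewrite -(eqp_map Phi) => /eqp_trans; apply.
  rewrite rmorph_prod big_map /= (eq_bigr (fun x => 'X - (Phi x)%:P)) ?eqpxx //.
  by move=> x _; rewrite map_polyXsubC.
rewrite (eqp_root Ers') root_prod_XsubC => /mapP[x xrs Ex].
exists x; first by rewrite (eqp_root Ers) root_prod_XsubC.
have rQ z : root (subst iota F f) z -> z != x -> root (map_poly j Q) (Phi z).
  rewrite -(fmorph_root Phi) EQ rootM expr1 root_XsubC Ex (inj_eq (fmorph_inj _)).
  by move=> /orP[->|].
move=> y z ry rz yx zx.
have [|g [gG gy gx]] := @gal_orbit _ _ _ _ phi j Phi PhiE [:: x] Q y z _ irQ (rQ _ ry yx) (rQ _ rz zx).
  by move=> u; rewrite inE => /eqP ->; exists w.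
by exists g; split=> //; apply: gx; rewrite inE.
Qed.

Lemma gal_2transitive F x y x' y' : admissible F -> subst_f n F %| P ->
    root (subst iota F f) x -> root (subst iota F f) y -> x != y ->
    root (subst iota F f) x' -> root (subst iota F f) y' -> x' != y' ->
  exists g, [/\ g \in G, g x = x' & g y = y'].
Proof.
move=> adF FP rx ry xy rx' ry' xy'.
have [z rz stab] := gal_stab_transitive adF FP.
have [g gG gx] := gal_transitive adF FP rx rz.
have [h hG hz] := gal_transitive adF FP rz rx'.
have ne u v (a : gal_of {:L}) : u != v -> a v != a u.
  by rewrite (inj_eq (fmorph_inj _)) eq_sym.
have hV : (h^-1)%g x' = z by rewrite -hz -galM ?memvf // mulgV gal_id.
have [||||b [bG bz by_]] := stab (g y) ((h^-1)%g y').
- exact: gal_root.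
- by apply: gal_root => //; rewrite groupV.
- by rewrite -gx ne.
- by rewrite -hV ne.
exists (g * b * h)%g; split; first by rewrite !groupM.
  by rewrite !galM ?memvf // gx bz.
by rewrite !galM ?memvf // by_ -galM ?memvf // mulVg gal_id.
Qed.
End Splitting.
End GenericRoots.

(** * Simple tangency *)

Lemma double_root (K : fieldType) (p : {poly K}) a : p.[a] = 0 -> p^`().[a] = 0 ->
  exists Y, p = ('X - a%:P) ^+ 2 * Y.
Proof.
move=> p0 p'0; have /factor_theorem[q Eq] : root p a by apply/rootP.
have : root q a.
  by apply/rootP; move: p'0; rewrite Eq derivM derivXsubC mulr1 hornerD hornerM hornerXsubC subrr mulr0 add0r.
by case/factor_theorem => Y EY; exists Y; rewrite Eq EY; ring.
Qed.

Section Tangent.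
Variables (k : closedFieldType) (n : nat) (L : splittingFieldType (ratfun k n.+1)).
Local Notation K := (ratfun k n.+1).
Local Notation iota := (const_in L).
Local Notation f := (generic_in L).
Variables (m : nat) (F : 'I_m -> {poly {poly k}}) (i : 'I_m).
Hypothesis n3 : (3 <= n)%N.
Hypothesis adF : forall j, admissible n (F j).
Hypothesis ndvdF : forall j j', j != j' -> ~ (exists Q, F j' = Q * F j).

(** Order of vanishing at x0 imposed on F_j(t, A): the graph of A is tangent to the i-th curve and
    misses the others there. *)
Definition contact (j : 'I_m) : nat := if j == i then 2 else 0.

Lemma contact_lt j : (contact j < (size (F j)).-1 * n)%N.
Proof.
apply: leq_ltn_trans (size_gt2 n3 (adF j)).
by rewrite /contact; case: ifP.
Qed.

Lemma subst_value (R : comNzRingType) (j : {rmorphism k -> R}) G (g h : {poly R}) x :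
  g.[x] = h.[x] -> (subst j G g).[x] = (subst j G h).[x].
Proof. by rewrite (horner_subst j G g x) (horner_subst j G h x) => ->. Qed.

Lemma tangent_pencil x0 : root (subst iota (F i) f) x0 ->
  exists (A : {poly L}) (c : k) (H : 'I_m -> {poly {poly L}}),
    [/\ (size A <= n.+1)%N, A`_n = f`_n + iota c, A.[x0] = f.[x0] &
    forall j, [/\ subst (polyC \o iota) (F j) (pencil A (('X - x0%:P) ^+ 2)) =
                    map_poly polyC (('X - x0%:P) ^+ contact j) * H j,
                  (H j).[x0%:P] != 0 & (H j)^`() != 0]].
Proof.
move=> rx0; have Fx0 := deriv_nonzero (adF i) rx0.
(* This slope correction cancels the derivative of F_i(t, A0) at x0, which is that of F_i(t, f) plus
   w F_x. *)
pose w := - (subst iota (F i) f)^`().[x0] / (subst iota (F i)^`() f).[x0].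
pose A0 := f + w *: ('X - x0%:P).
pose A (c : k) := A0 + iota c *: ('X - x0%:P) ^+ 3.
(* Each j excludes at most one constant c, and k is infinite. *)
have [b bP] : {b : 'I_m -> k & forall j c, tangency iota (F j) x0 (contact j) (A c) = 0 -> c = b j}.
  apply: (@choice _ _ (fun j b => forall c, tangency iota (F j) x0 (contact j) (A c) = 0 -> c = b)).
  move=> j; have [[b Eb]|nb] := pselect (exists b, tangency iota (F j) x0 (contact j) (A b) = 0).
    exists b => c Ec; apply: (fmorph_inj iota).
    by apply: tangency_unique Ec Eb; have [] := adF j.
  by exists 0 => c Ec; case: nb; exists c.
have [c cb] := avoid_seq (codom b).
have Tc j : tangency iota (F j) x0 (contact j) (A c) != 0.
  by apply: contra cb => /eqP /bP ->; apply: codom_f.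
have Ax0 : (A c).[x0] = f.[x0].
  by rewrite /A /A0 !hornerD !hornerZ horner_exp hornerXsubC subrr expr0n /= !mulr0 !addr0.
have A'x0 : (A c)^`().[x0] = f^`().[x0] + w.
  rewrite /A /A0 !derivD !derivZ deriv_exp derivXsubC mul1r !hornerD !hornerZ hornerMn.
  by rewrite horner_exp hornerXsubC subrr expr0n hornerC mulr1 mul0rn mulr0 addr0.
have ex j : exists H, [/\ subst (polyC \o iota) (F j) (pencil (A c) (('X - x0%:P) ^+ 2)) =
    map_poly polyC (('X - x0%:P) ^+ contact j) * H & H.[x0%:P] != 0].
  rewrite /contact; case: eqP => [->|/eqP ji].
    have p0 : (subst iota (F i) (A c)).[x0] = 0 by rewrite (subst_value _ _ Ax0) (rootP rx0).
    have p'0 : (subst iota (F i) (A c))^`().[x0] = 0.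
      rewrite deriv_subst hornerD hornerM !(subst_value _ _ Ax0) A'x0.
      rewrite /w.
      have -> : (subst iota (F i) f)^`().[x0] = (subst iota (map_poly (@deriv k) (F i)) f).[x0]
          + (subst iota (F i)^`() f).[x0] * f^`().[x0] by rewrite deriv_subst hornerD hornerM.
      by field.
    have [Y EY] := double_root p0 p'0.
    by have [|H [EH Hx0]] := pencil_tangent EY; [rewrite (subst_value _ _ Ax0) | exists H].
  (* For j other than i the cofactor is F_j(t, A + u (t - x0)^2) itself; at t = x0 and u = 0 it
     equals F_j(x0, f(x0)), nonzero because F_i does not divide F_j. *)
  eexists; rewrite expr0 map_polyC mul1r; split; first by [].
  apply/eqP => /(congr1 (horner_eval (0 : L))).
  rewrite rmorph0 -horner_map map_subst pencil0.
  have -> : subst (horner_eval (0 : L) \o (polyC \o iota)) (F j) (A c) = subst iota (F j) (A c).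
    by apply: eq_subst => a; apply: hornerC.
  rewrite [X in _.[X]](hornerC x0 0).
  rewrite (subst_value _ _ Ax0) => /eqP; apply/negP.
  by apply: cofactor_nonzero rx0; [have [] := adF i | apply: ndvdF; rewrite eq_sym].
have [H HP] := choice ex.
have szA : (size (A c) <= n.+1)%N.
  rewrite /A /A0; apply: leq_trans (size_polyD _ _) _; rewrite geq_max; apply/andP; split.
    apply: leq_trans (size_polyD _ _) _; rewrite geq_max size_generic_in /=.
    by apply: leq_trans (size_scale_leq _ _) _; rewrite size_XsubC ltnS ltnW // ltnW.
  by apply: leq_trans (size_scale_leq _ _) _; rewrite size_exp_XsubC ltnS.
(* The cubic correction reaches the coefficient of t^n only when n = 3. *)
exists (A c), (c *+ (n == 3)), H; split=> //; last first.
  move=> j; have [EH Hx0] := HP j; split=> //.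
  by apply: contra (Tc j) => /eqP H'0; apply/eqP; apply: inseparable_tangency EH H'0.
rewrite /A /A0 !coefD !coefZ [('X - _)`_n]nth_default ?size_XsubC ?(ltnW n3) // mulr0 addr0.
congr (_ + _); rewrite rmorphMn /= -mulr_natr; congr (_ * _).
suff cf l : (3 <= l)%N -> (('X - x0%:P) ^+ 3)`_l = (l == 3)%:R by apply: cf.
case: eqP => [-> _|ne l3]; last first.
  by rewrite nth_default // size_exp_XsubC ltn_neqAle l3 andbT eq_sym; apply/eqP.
have /monicP := monic_exp 3 (monicXsubC x0).
by rewrite lead_coefE size_exp_XsubC.
Qed.

Lemma tangent_pencil_size j x0 (A : {poly L}) c :
    (size A <= n.+1)%N -> A`_n = f`_n + iota c ->
  size (subst (polyC \o iota) (F j) (pencil A (('X - x0%:P) ^+ 2))) = ((size (F j)).-1 * n).+1.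
Proof.
move=> szA Ac; set B := ('X - x0%:P) ^+ 2.
have szB : size B = 3 by rewrite size_exp_XsubC.
have sg : (size (pencil A B) <= n.+1)%N.
  rewrite /pencil; apply: leq_trans (size_polyD _ _) _; rewrite geq_max.
  rewrite size_map_polyC szA /= size_Cmul ?polyX_eq0 // size_map_polyC szB.
  exact: ltnW.
apply: (@size_subst_generic _ _ _ _ _ _ _ L (horner_eval 0) idfun c) => //.
  by rewrite -coef_map pencil0.
by move=> a; apply: hornerC.
Qed.

(** Over the fraction field of L[u] each H_j is irreducible with nonzero derivative, hence
    separable; Om is an extension where their product splits. *)
Lemma residual_splitting x0 A (H : 'I_m -> {poly {poly L}}) :
    (forall j, [/\ subst (polyC \o iota) (F j) (pencil A (('X - x0%:P) ^+ 2)) =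
                    map_poly polyC (('X - x0%:P) ^+ contact j) * H j,
                  (H j).[x0%:P] != 0 & (H j)^`() != 0]) ->
    (size A <= n.+1)%N -> (exists c, A`_n = f`_n + iota c) ->
  exists (Om : fieldType) (sig : {rmorphism {poly L} -> Om}), injective sig /\
    forall j, exists (rs : seq Om) a, [/\ uniq rs, sig x0%:P \notin rs &
      map_poly sig (H j) = a *: \prod_(r <- rs) ('X - r%:P)].
Proof.
move=> HP szA [c Ac].
have [M [tau tauP]] := fraction_field_exists {poly L}.
have irQ j : irreducible_poly (map_poly tau (H j)).
  have [EH Hx0 _] := HP j; have [irF _ _ _] := adF j.
  apply: (pencil_irreducible irF EH Hx0 tauP).
  have H0 : H j != 0 by apply: contraNneq Hx0 => ->; rewrite horner0.
  have szH := tangent_pencil_size j x0 szA Ac.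
  have := szH; rewrite EH size_monicM //; last first.
    by rewrite map_monic ?monic_exp ?monicXsubC //; apply: polyC_inj.
  rewrite size_map_polyC size_exp_XsubC; have := contact_lt j.
  by case: (size (H j)) => [|[|s]] //=; rewrite ?addnS ?addn0 /=; lia.
have sepQ j : separable_poly (map_poly tau (H j)).
  apply: irreducible_separable => //; have [_ _ H'0] := HP j.
  by rewrite deriv_map -size_poly_eq0 size_map_fraction // size_poly_eq0.
have Q0 : \prod_j map_poly tau (H j) != 0.
  by apply/prodf_neq0 => j _; apply: irredp_neq0.
have [Om [j1 [rs Ers]]] := splitting_extension Q0.
exists Om, (j1 \o tau); split; first by move=> x y /fmorph_inj /tauP.1.
move=> j; have [_ Hx0 _] := HP j.
have : map_poly j1 (map_poly tau (H j)) %| \prod_(r <- rs) ('X - r%:P).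
  rewrite -(eqp_dvdr _ Ers) dvdp_map (bigD1 j) //=; exact: dvdp_mulr.
case/dvdp_prod_XsubC => mk Emk.
have [[a b] /= /andP[a0 b0] Eab] := eqpP _ _ Emk.
have Ef : map_poly (j1 \o tau) (H j) = (b / a) *: \prod_(r <- mask mk rs) ('X - r%:P).
  apply: (scalerI a0); rewrite map_poly_comp Eab scalerA mulrC divfK //.
exists (mask mk rs), (b / a); split=> //.
  rewrite -(separable_prod_XsubC (mask mk rs)) -(eqp_separable Emk).
  by rewrite separable_map.
by rewrite -root_prod_XsubC -(eqp_root Emk) /= fmorph_root rootE horner_map (fraction_eq0 tauP).
Qed.
End Tangent.

(** * Ramification *)

Section Smoothing.
Variables (k : closedFieldType) (Om : fieldType) (kO : {rmorphism k -> Om}).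
Implicit Types (F : {poly {poly k}}) (f A : {poly Om}).

(* The deformation f + (1 - s) (A - f + s): equal to A at s = 0, to f at s = 1, and with
   s-derivative 1 at s = 0 wherever A = f. *)
Definition smoothing f A : {poly {poly Om}} :=
  map_poly polyC f + (1 - 'X)%:P * (map_poly polyC (A - f) + 'X%:P).

Lemma smoothing0 f A : map_poly (horner_eval 0) (smoothing f A) = A.
Proof.
have E (p : {poly Om}) : map_poly (horner_eval 0) (map_poly polyC p) = p.
  by rewrite -map_poly_comp map_poly_id // => c _ /=; apply: hornerC.
rewrite /smoothing [LHS]rmorphD [X in _ + X]rmorphM [X in _ + _ * X]rmorphD /= !map_polyC /= !E.
have -> : horner_eval (0 : Om) (1 - 'X) = 1.
  by rewrite horner_evalE hornerD hornerN hornerX -polyC1 hornerC subr0.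
have -> : horner_eval (0 : Om) 'X = 0 by apply: hornerX.
by rewrite polyC0 addr0 polyC1 mul1r addrC subrK.
Qed.

Lemma smoothing1 f A : map_poly (horner_eval 1) (smoothing f A) = f.
Proof.
have E (p : {poly Om}) : map_poly (horner_eval 1) (map_poly polyC p) = p.
  by rewrite -map_poly_comp map_poly_id // => c _ /=; apply: hornerC.
rewrite /smoothing [LHS]rmorphD [X in _ + X]rmorphM [X in _ + _ * X]rmorphD /= !map_polyC /= !E.
have -> : horner_eval (1 : Om) (1 - 'X) = 0.
  by rewrite horner_evalE hornerD hornerN hornerX -polyC1 hornerC subrr.
by rewrite polyC0 mul0r addr0.
Qed.

Lemma size_smoothing f A n : (size f <= n.+1)%N -> (size A <= n.+1)%N ->
  (size (smoothing f A) <= n.+1)%N.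
Proof.
move=> sf sA; rewrite /smoothing; apply: leq_trans (size_polyD _ _) _; rewrite geq_max.
rewrite size_map_polyC sf /= mul_polyC; apply: leq_trans (size_scale_leq _ _) _.
apply: leq_trans (size_polyD _ _) _; rewrite geq_max size_map_polyC.
apply/andP; split; last by apply: leq_trans (size_polyC_leq1 _) _.
by apply: leq_trans (size_polyD _ _) _; rewrite geq_max sA size_polyN sf.
Qed.

(* Eisenstein: at a point reducing to a double root a of F(t, A), the equation
   F(t, smoothing) = 0 modulo s^2 reads s F_x(a, A(a)) = 0. *)
Lemma smoothing_no_root F f A a S (y : series Om) :
    subst kO F A = ('X - a%:P) ^+ 2 * S -> A.[a] = f.[a] ->
    (subst kO F^`() A).[a] != 0 -> residue y = a ->
  ~~ root (map_poly (@of_poly Om) (subst (polyC \o kO) F (smoothing f A))) y.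
Proof.
move=> EA Aa Fa ry; apply: contra Fa => /rootP; rewrite map_subst.
pose s := uniformizer Om; pose cst := (@of_poly Om \o polyC : {rmorphism Om -> series Om}).
(* Rewriting f + (1 - s) (A - f + s) as A + s V, where V(y) has residue 1 because A(a) = f(a). *)
pose V : {poly series Om} := (1 - s)%:P - map_poly cst (A - f).
have -> : map_poly (@of_poly Om) (smoothing f A) = map_poly cst A + s%:P * V.
  rewrite /smoothing [LHS]rmorphD [X in _ + X]rmorphM [X in _ + _ * X]rmorphD /=.
  rewrite !map_polyC /= -!map_poly_comp /V.
  rewrite !rmorphB /= -/s polyC1 -[map_poly (_ \o _) f]/(map_poly cst f).
  rewrite -[map_poly (_ \o _) A]/(map_poly cst A).
  by ring.
rewrite -[subst _ F _]/(subst (cst \o kO) F _).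
have [r ->] := subst_taylor (cst \o kO) F (map_poly cst A) (s%:P * V).
rewrite -!map_subst EA rmorphM rmorphXn /= map_polyXsubC.
have [z Ez] : exists z, y - cst a = s * z.
  by apply: residue_eq0P; rewrite rmorphB /= ry residue_of_poly hornerC subrr.
have res p : residue (map_poly cst p).[y] = p.[a].
  rewrite -horner_map /= ry -map_poly_comp map_poly_id // => c _ /=.
  by rewrite residue_of_poly hornerC.
rewrite !expr2 !hornerD !hornerM hornerC hornerXsubC [y - _]Ez.
set Sy := (map_poly cst S).[y]; set Fy := (map_poly cst _).[y].
(* Since y - a = s z, the double root contributes a multiple of s^2; one factor s is cancelled
   before reducing modulo s. *)
move=> E; have /eqP : s * (s * z ^+ 2 * Sy + Fy * V.[y] + s * (r.[y] * V.[y] ^+ 2)) = 0.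
  by rewrite -E; ring.
rewrite mulf_eq0 (negbTE (uniformizer_neq0 Om)) /= => /eqP /(congr1 (@residue Om)).
rewrite rmorph0 !rmorphD !rmorphM /= residue_uniformizer !mul0r add0r addr0 res.
have -> : residue V.[y] = 1.
  rewrite /V hornerD hornerN hornerC !rmorphB rmorph1 /= residue_uniformizer -rmorphB /= res.
  by rewrite hornerD hornerN Aa subrr !subr0.
by rewrite mulr1 => ->.
Qed.
End Smoothing.

(** * The ramified specialization and the transposition *)

Section Transposition.
Variables (k : closedFieldType) (n : nat) (L : splittingFieldType (ratfun k n.+1)).
Local Notation K := (ratfun k n.+1).
Local Notation iota := (const_in L).
Local Notation f := (generic_in L).
Variables (m : nat) (F : 'I_m -> {poly {poly k}}) (i : 'I_m).
Hypothesis n3 : (3 <= n)%N.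
Hypothesis char2 : (2%:R : k) != 0.
Hypothesis adF : forall j, admissible n (F j).
Hypothesis ndvdF : forall j j', j != j' -> ~ (exists Q, F j' = Q * F j).
Let P := \prod_j subst_f n (F j).
Hypothesis splitP : splittingFieldFor 1%VS (map_poly (in_alg L) P) fullv.

Lemma prod_subst_f_neq0 : P != 0.
Proof.
by apply/prodf_neq0 => j _; rewrite -size_poly_gt0 (size_subst_f L (adF j)).
Qed.

Lemma subst_f_dvd j : subst_f n (F j) %| P.
Proof. by rewrite /P (bigD1 j) //= dvdp_mulr. Qed.

(* Here M = Frac Om[[s]], and q j is the factor of F_j(t, g) that reduces to a constant multiple
   of a power of t - x0 at s = 0. *)
Lemma ramified_embedding :
  exists (M Lam : fieldType) (phi : {rmorphism K -> M}) (jj : {rmorphism M -> Lam})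
      (Phi : {rmorphism L -> Lam}) (q : 'I_m -> {poly M}) (ys : 'I_m -> seq M),
    [/\ forall a : K, Phi a%:A = jj (phi a),
        irreducible_poly (q i) /\ size (q i) = 3,
        forall j, j != i -> size (q j) = 1,
        forall j, uniq (ys j) &
        forall j, map_poly Phi (subst iota (F j) f) =
          map_poly jj (q j * \prod_(y <- ys j) ('X - y%:P))].
Proof.
have [x0 rx0] := exists_root splitP n3 (adF i) (subst_f_dvd i).
have [A [c [H [szA An Ax0 HP]]]] := tangent_pencil n3 adF ndvdF rx0.
have [Om [sig [siginj spl]]] := residual_splitting n3 adF HP szA (ex_intro _ c An).
pose kap : {rmorphism L -> Om} := sig \o polyC.
pose kO : {rmorphism k -> Om} := kap \o iota.
(* [AT] is the generic member of the tangent pencil, with u sent to [sig 'X]. *)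
pose a := sig x0%:P; pose AT := map_poly sig (pencil A (('X - x0%:P) ^+ 2)).
pose fO := map_poly kap f.
have ATE : AT = map_poly kap A + (sig 'X) *: ('X - a%:P) ^+ 2.
  rewrite /AT /pencil rmorphD rmorphM /= map_polyC /= mul_polyC.
  by rewrite rmorphXn /= map_polyXsubC rmorphXn /= map_polyXsubC -map_poly_comp.
have sAT : (size AT <= n.+1)%N.
  rewrite ATE; apply: leq_trans (size_polyD _ _) _; rewrite geq_max size_map_poly szA /=.
  by apply: leq_trans (size_scale_leq _ _) _; rewrite size_exp_XsubC ltnW.
have ATa : AT.[a] = fO.[a].
  rewrite ATE hornerD hornerZ horner_exp hornerXsubC subrr expr0n mulr0 addr0.
  by rewrite -[a]/(kap x0) !horner_map Ax0.
have sfO : (size fO <= n.+1)%N by rewrite size_map_poly size_generic_in.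
pose G := smoothing fO AT.
have sG : (size G <= n.+1)%N := size_smoothing sfO sAT.
have [M [tau tauP]] := fraction_field_exists (series Om).
have [phi phiE] : exists phi : {rmorphism K -> M}, forall F,
    map_poly phi (subst_f n F) = map_poly (tau \o @of_poly Om) (subst (polyC \o kO) F G).
  apply: (@generic_embedding _ _ _ _ _ _ _ _ (tau \o @of_poly Om) (horner_eval 1) kap) => //.
  - by move=> x y /tauP.1 /of_poly_inj.
  - by rewrite smoothing1.
  by move=> b; apply: hornerC.
pose p j := map_poly (@of_poly Om) (subst (polyC \o kO) (F j) G).
have resp j : map_poly (@residue Om) (p j) = subst kO (F j) AT.
  rewrite /p -map_poly_comp -[in RHS](smoothing0 fO AT).
  transitivity (map_poly (horner_eval 0) (subst (polyC \o kO) (F j) G)).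
    by apply: eq_map_poly => b; apply: residue_of_poly.
  rewrite map_subst; apply: eq_subst => b; exact: hornerC.
have resE j : subst kO (F j) AT = ('X - a%:P) ^+ contact i j * map_poly sig (H j).
  have [EH _ _] := HP j.
  transitivity (map_poly sig (subst (polyC \o iota) (F j) (pencil A (('X - x0%:P) ^+ 2)))).
    by rewrite map_subst.
  by rewrite EH rmorphM /= !rmorphXn /= !map_polyXsubC.
have szres j : size (subst kO (F j) AT) = ((size (F j)).-1 * n).+1.
  rewrite -(tangent_pencil_size n3 adF j x0 szA An).
  rewrite -(@size_map_inj_poly _ _ sig) ?rmorph0 //; first by rewrite map_subst.
have szp j : size (p j) = ((size (F j)).-1 * n).+1.
  apply/eqP; rewrite eqn_leq; apply/andP; split.
    have [irF _ r0 slF] := adF j; have [l _ lP] := subst_top irF.1 r0 slF.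
    by apply: leq_trans (size_poly _ _) _; case: (lP _ (polyC \o kO) G sG).
  by rewrite -szres -resp size_poly.
(* The simple roots of the reduction lift to series. The remaining factor reduces, without loss of
   degree, to a multiple of (t - a)^e with e = [contact i j], so its roots in Om[[s]] reduce to
   a. *)
have ex j : exists qy : {poly series Om} * seq (series Om),
    [/\ p j = qy.1 * \prod_(y <- qy.2) ('X - y%:P), uniq qy.2,
        size (map_poly (@residue Om) qy.1) = size qy.1, size qy.1 = (contact i j).+1 &
        forall y, root qy.1 y -> residue y = a].
  have [rs [b [urs ars Eb]]] := spl j.
  have Eres : map_poly (@residue Om) (p j) =
      (b *: ('X - a%:P) ^+ contact i j) * \prod_(r <- rs) ('X - r%:P).
    by rewrite resp resE Eb -!mul_polyC; ring.
  have b0 : b != 0.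
    have : size (map_poly (@residue Om) (p j)) != 0 by rewrite resp szres.
    by apply: contraNneq => b0; rewrite Eres b0 scale0r mul0r size_poly0.
  have [|ys [q [Eys Eq Et]]] := hensel_split Eres urs.
    move=> r rrs; rewrite hornerZ horner_exp hornerXsubC mulf_neq0 // expf_neq0 //.
    by rewrite subr_eq0; apply: contraNneq ars => ra; rewrite -[sig _]/a -ra.
  have szt : size (map_poly (@residue Om) q) = (contact i j).+1.
    by rewrite Et size_scale // size_exp_XsubC.
  have szq : size q = (contact i j).+1.
    have q0 : q != 0 by apply: contra_eq_neq szt => ->; rewrite rmorph0 size_poly0.
    have : size (p j) = size (map_poly (@residue Om) (p j)) by rewrite szp resp szres.
    rewrite Eq rmorphM rmorph_prod /=.
    rewrite size_Mmonic // ?monic_prod_XsubC // size_prod_XsubC.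
    rewrite (eq_bigr (fun y => 'X - (residue y)%:P)); last by move=> y _; rewrite map_polyXsubC.
    rewrite -(big_map (@residue Om) xpredT (fun y => 'X - y%:P)) Eys.
    rewrite size_Mmonic ?monic_prod_XsubC //; last by rewrite -size_poly_gt0 szt.
    rewrite size_prod_XsubC -Eys size_map szt !addnS /=.
    by move/eqP; rewrite eqn_add2r => /eqP.
  exists (q, ys); split=> //=.
  - by apply: (@map_uniq _ _ (@residue Om)); rewrite Eys.
  - by rewrite szq.
  move=> y ry; have : root (map_poly (@residue Om) q) (residue y).
    by rewrite rootE horner_map (rootP ry) rmorph0.
  rewrite Et rootZ // /root horner_exp hornerXsubC expf_eq0 subr_eq0 => /andP[_ /eqP].
  by [].
have [qy qyP] := choice ex.
pose q j := map_poly tau (qy j).1.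
have szq j : size (q j) = (contact i j).+1.
  by rewrite /q size_map_fraction //; have [_ _ _ ->] := qyP j.
have contactii : contact i i = 2 by rewrite /contact eqxx.
have qirr : irreducible_poly (q i).
  have [Ep _ szr szqi rq] := qyP i.
  have q0 : (qy i).1 != 0 by rewrite -size_poly_gt0 szqi.
  (* A quadratic without roots in M is irreducible. By integrality a root would be a series reducing
     to a, which [smoothing_no_root] excludes. *)
  apply: cubic_irreducible; first by rewrite szq contactii.
  move=> z; apply/negP => rz; have [y Ey] := series_integral_root tauP szr q0 rz.
  move: rz; rewrite Ey rootE horner_map (fraction_eq0 tauP) => /eqP/rootP ry.
  have ra := rq y ry.
  have Fa : (subst kO (F i)^`() AT).[a] != 0.
    rewrite (subst_value _ _ ATa) -[subst kO _ fO]/(subst (kap \o iota) _ fO) -map_subst.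
    by rewrite -[a]/(kap x0) horner_map fmorph_eq0 (deriv_nonzero (adF i) rx0).
  have := resE i; rewrite contactii => EA.
  case/negP: (smoothing_no_root EA ATa Fa ra); rewrite -/G -/(p i) Ep.
  by rewrite rootM ry.
have phiP0 : map_poly phi P != 0 by rewrite map_poly_eq0 prod_subst_f_neq0.
have [Lam [jj splj]] := splitting_extension phiP0.
have [Phi PhiE] : exists Phi : {rmorphism L -> Lam}, forall a : K, Phi a%:A = (jj \o phi) a.
  by apply: lift_embedding splitP _; rewrite map_poly_comp.
exists M, Lam, phi, jj, Phi, q, (fun j => map tau (qy j).2); split=> //.
- by rewrite szq contactii.
- by move=> j ji; rewrite szq /contact (negbTE ji).
- by move=> j; rewrite map_inj_uniq; [have [] := qyP j | apply: tauP.1].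
move=> j; rewrite -subst_f_in -map_poly_comp.
have -> : map_poly (Phi \o in_alg L) (subst_f n (F j)) = map_poly jj (map_poly phi (subst_f n (F j))).
  by rewrite -map_poly_comp; apply: eq_map_poly => b; apply: PhiE.
congr (map_poly jj _); rewrite phiE map_poly_comp -/(p j).
have [-> _ _ _ _] := qyP j.
rewrite rmorphM rmorph_prod /= big_map; congr (_ * _).
by apply: eq_bigr => y _; rewrite map_polyXsubC.
Qed.

Lemma irreducible_no_root (M : fieldType) (q : {poly M}) y :
  irreducible_poly q -> size q = 3 -> ~~ root q y.
Proof.
move=> irq szq; apply/negP; rewrite -dvdp_XsubCl => dv.
have := irq.2 _ _ dv; rewrite size_XsubC => /(_ isT) /eqp_size.
by rewrite szq size_XsubC.
Qed.

(** All the roots become rational over M except the two roots of [q i], which are distinct and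
    conjugate; [gal_orbit] is applied with all the other roots in [xs]. That g y = x follows, as g
    permutes the roots. *)
Lemma transposition :
  exists rs : seq L,
    [/\ uniq rs, size rs = ((size (F i)).-1 * n)%N,
        forall x, root (subst iota (F i) f) x = (x \in rs) &
    exists x y g, [/\ [/\ x \in rs, y \in rs & x != y], g \in ('Gal({:L} / 1%VS))%g, g x = y &
      forall j z, root (subst iota (F j) f) z -> z != x -> z != y -> g z = z]].
Proof.
have [M [Lam [phi [jj [Phi [q [ys [PhiE [irq szq] szqj uys EP]]]]]]]] := ramified_embedding.
have [rs Ers] := subst_f_splits splitP (subst_f_dvd i).
have ErsPhi : map_poly Phi (subst iota (F i) f) %= \prod_(x <- map Phi rs) ('X - x%:P).
  have := Ers; rewrite -(eqp_map Phi) => /eqp_trans; apply.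
  rewrite rmorph_prod big_map /= (eq_bigr (fun x => 'X - (Phi x)%:P)) ?eqpxx //.
  by move=> x _; rewrite map_polyXsubC.
have Eys j : map_poly jj (\prod_(y <- ys j) ('X - y%:P)) = \prod_(y <- map jj (ys j)) ('X - y%:P).
  by rewrite rmorph_prod big_map; apply: eq_bigr => y _; rewrite /= map_polyXsubC.
have EPi := EP i; rewrite rmorphM /= Eys in EPi.
have : map_poly jj (q i) %| \prod_(x <- map Phi rs) ('X - x%:P).
  by rewrite -(eqp_dvdr _ ErsPhi) EPi dvdp_mulr.
case/dvdp_prod_XsubC => mk; set zs := mask mk _ => Ezs.
have szzs : size zs = 2.
  by have := eqp_size Ezs; rewrite size_map_poly szq size_prod_XsubC => -[].
have two (R : fieldType) (h : {rmorphism k -> R}) : (2%:R : R) != 0.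
  by rewrite -(rmorph_nat h) fmorph_eq0.
(* The derivative of the quadratic has leading coefficient 2 q_2; this is where characteristic 2 is
   excluded. *)
have q'0 : (q i)^`() != 0.
  have : (q i)`_2 *+ 2 != 0.
    rewrite -mulr_natr mulf_neq0 ?(two _ (phi \o ratconst k n)) //.
    by have := lead_coef_eq0 (q i); rewrite lead_coefE szq /= => ->; apply: irredp_neq0.
  by apply: contraNneq => E; rewrite -(coef_deriv (q i) 1) E coef0.
have uzs : uniq zs.
  rewrite -(separable_prod_XsubC zs) -(eqp_separable Ezs) separable_map.
  exact: irreducible_separable.
have perm : perm_eq (map Phi rs) (zs ++ map jj (ys i)).
  apply: prod_XsubC_eq; rewrite big_cat /=; apply/eqP.
  rewrite -eqp_monic ?monic_prod_XsubC ?monicMl ?monic_prod_XsubC //.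
  by apply: eqp_trans (eqp_mulr _ Ezs); rewrite -EPi eqp_sym.
have zsM y : jj y \notin zs.
  by rewrite -root_prod_XsubC -(eqp_root Ezs) fmorph_root irreducible_no_root.
have uall : uniq (zs ++ map jj (ys i)).
  rewrite cat_uniq uzs (map_inj_uniq (fmorph_inj _)) uys andbT /=.
  by apply/hasPn => _ /mapP[y _ ->]; apply: zsM.
have urs : uniq rs by apply: (map_uniq (f := Phi)); rewrite (perm_uniq perm).
have rsE x : root (subst iota (F i) f) x = (x \in rs).
  by rewrite (eqp_root Ers) root_prod_XsubC.
exists rs; split=> //.
  have := eqp_size Ers; rewrite -{1}subst_f_in size_map_poly (size_subst_f L (adF i)).
  by rewrite size_prod_XsubC => -[].
have [z1 [z2 Ez]] : exists z1 z2, zs = [:: z1; z2].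
  by case: (zs) szzs => [|z1 [|z2 [|]]] // _; exists z1, z2.
have pre z : z \in zs -> exists2 x, x \in rs & z = Phi x.
  by move=> zzs; apply/mapP; rewrite (perm_mem perm) mem_cat zzs.
have [x xrs Ex] : exists2 x, x \in rs & z1 = Phi x by apply: pre; rewrite Ez mem_head.
have [y yrs Ey] : exists2 x, x \in rs & z2 = Phi x by apply: pre; rewrite Ez !inE eqxx orbT.
have xy : x != y.
  by move: uzs; rewrite Ez Ex Ey /= inE (inj_eq (fmorph_inj _)) andbT.
have okM j z : root (subst iota (F j) f) z -> z != x -> z != y -> exists w, Phi z = jj w.
  have [->|ji] := eqVneq j i.
    rewrite rsE => zrs zx zy; have : Phi z \in zs ++ map jj (ys i).
      by rewrite -(perm_mem perm) map_f.
    rewrite mem_cat Ez !inE Ex Ey !(inj_eq (fmorph_inj _)) (negbTE zx) (negbTE zy) /=.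
    by case/mapP => w _ ->; exists w.
  rewrite -(fmorph_root Phi) EP rmorphM rootM /= Eys root_prod_XsubC => + _ _.
  have /eqP/size_poly1P[b b0 ->] := szqj j ji.
  rewrite map_polyC rootC fmorph_eq0 (negbTE b0) /=.
  by case/mapP => w _ ->; exists w.
have [rP ErP _] := splitP.
pose xs := [seq z <- rP | (z != x) && (z != y)].
have rootProd z : root (map_poly (in_alg L) P) z -> exists j, root (subst iota (F j) f) z.
  rewrite /P rmorph_prod rootE horner_prod => /prodf_eq0[j _] /=.
  by rewrite subst_f_in => rj; exists j.
have [||| g [gG gx gfix]] := @gal_orbit _ L M Lam phi jj Phi PhiE xs (q i) x y _ irq.
- move=> z; rewrite mem_filter => /andP[/andP[zx zy] zP].
  have [|j rj] := rootProd z; first by rewrite (eqp_root ErP) root_prod_XsubC.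
  exact: okM rj zx zy.
- by rewrite -Ex (eqp_root Ezs) root_prod_XsubC Ez mem_head.
- by rewrite -Ey (eqp_root Ezs) root_prod_XsubC Ez !inE eqxx orbT.
exists x, y, g; split=> // j z rz zx zy; apply: gfix; rewrite mem_filter zx zy /=.
rewrite -root_prod_XsubC -(eqp_root ErP) /P rmorph_prod (bigD1 j) //= rootM.
by rewrite subst_f_in rz.
Qed.
End Transposition.

(** * The product of symmetric groups *)

Theorem theorem2p4 (p : nat) (k : closedFieldType) (m n : nat)
  (F : 'I_m -> {poly {poly k}}) (L : splittingFieldType (ratfun k n.+1)) :
  prime p -> (2 < p)%N -> is_Fpbar p k ->
  (forall i, F i \is monic) ->
  (forall i, (0 < (size (F i)).-1)%N) ->
  (forall i, ring_irreducible (F i)) ->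
  (forall i, sep_over p (F i)) ->
  (forall i j, i != j -> forall c : k, c != 0 -> F i != (c%:P)%:P * F j) ->
  (3 <= n)%N ->
  (forall i, sl_le (F i) n) ->
  splittingFieldFor 1%VS
    (map_poly (in_alg L) (\prod_(i < m) subst_f n (F i))) fullv ->
  (* N_i = deg_t F_i(t,f) = r_i n *)
  (forall i, (size (subst_f n (F i))).-1 = ((size (F i)).-1 * n)%N) /\
  (* F_i(t,f) has exactly N_i roots in L *)
  (forall i, exists rs : seq L,
     [/\ uniq rs, size rs = ((size (F i)).-1 * n)%N &
         forall x, root (map_poly (in_alg L) (subst_f n (F i))) x = (x \in rs)]) /\
  (* Gal(L/k(a)) -> S_{N_1} x ... x S_{N_m} is onto *)
  (forall s : 'I_m -> L -> L,
     (forall i,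
        {in root (map_poly (in_alg L) (subst_f n (F i))) &, injective (s i)} /\
        (forall x, root (map_poly (in_alg L) (subst_f n (F i))) x ->
           root (map_poly (in_alg L) (subst_f n (F i))) (s i x))) ->
     exists2 g, g \in ('Gal(fullv / 1%VS))%g &
       forall i x, root (map_poly (in_alg L) (subst_f n (F i))) x -> g x = s i x).
Proof.
move=> pp p2 [pk _] monF szF irF sepF nassF n3 slF splitP.
have natk (R : nzRingType) (h : {rmorphism k -> R}) j : ~~ (p %| j)%N -> (j%:R : R) != 0.
  by move=> pj; rewrite -(rmorph_nat h) fmorph_eq0 -(dvdn_pcharf pk).
have char2 : (2%:R : k) != 0.
  by apply: (natk _ idfun); apply/negP => /(dvdn_leq (ltn0Sn 1)); rewrite leqNgt p2.
have irmF i : irr_monic (F i) by apply: ring_irr_monic.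
have adF i : admissible n (F i).
  split=> //; have [j pj Fj] := sepF i.
  have j0 : (0 < j)%N by case: j pj {Fj} => //; rewrite dvdn0.
  (* The derivative in x has the coefficient j F_j, nonzero when p does not divide j. *)
  apply: contraNneq Fj => F'0; have := coef_deriv (F i) j.-1.
  rewrite F'0 coef0 prednK // -mulr_natr => /esym/eqP.
  by rewrite mulf_eq0 (negbTE (natk _ polyC _ pj)) orbF.
have ndvdF i j : i != j -> ~ (exists Q, F j = Q * F i).
  move=> ij; apply: irr_monic_ndvd => //; first by have := szF i; case: (size (F i)) => [|[]].
  (* Both polynomials are monic, so the constant to exclude is 1. *)
  by have := nassF i j ij 1 (oner_neq0 _); rewrite !polyC1 mul1r.
have trans i := transposition i n3 char2 adF ndvdF splitP.
have P0 := prod_subst_f_neq0 L adF.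
have FP i := subst_f_dvd n F i.
split; first by move=> i; rewrite (size_subst_f L (adF i)).
split.
  move=> i; have [rs [urs szrs rsE _]] := trans i; exists rs; split=> // x.
  by rewrite subst_f_in.
move=> s sP; have [rP ErP _] := splitP.
apply: (@gal_all_perms _ L m (fun i => root (map_poly (in_alg L) (subst_f n (F i)))) rP) => //.
- move=> i x rx; rewrite -root_prod_XsubC -(eqp_root ErP) rmorph_prod (bigD1 i) //=.
  by rewrite rootM rx.
- move=> i j x; rewrite !subst_f_in => ri rj; apply/eqP; apply: contraT => ij.
  by have := cofactor_nonzero (irmF i) (ndvdF i j ij) ri; rewrite -[_ == 0]/(root _ x) rj.
- by move=> i g x gG; rewrite !subst_f_in; apply: gal_root.
move=> i y1 y2; rewrite !subst_f_in => r1 r2 y12.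
have [rs [_ _ rsE [x1 [x2 [g [[x1rs x2rs x12] gG gx gfix]]]]]] := trans i.
rewrite -rsE in x1rs; rewrite -rsE in x2rs.
have [h [hG h1 h2]] := gal_2transitive splitP P0 n3 (adF i) (FP i) x1rs x2rs x12 r1 r2 y12.
have hV u v : h u = v -> (h^-1)%g v = u by move=> <-; rewrite -galM ?memvf // mulgV gal_id.
(* Products act from left to right: y1 goes to x1, then to x2, then to y2. *)
exists (h^-1 * g * h)%g; first by rewrite !groupM ?groupV.
split; first by rewrite !galM ?memvf // (hV _ _ h1) gx h2.
move=> j z rz zy1 zy2; rewrite !galM ?memvf // (gfix j).
- by rewrite -galM ?memvf // mulVg gal_id.
- by apply: gal_root; [rewrite groupV | rewrite -subst_f_in].
- by apply: contraNneq zy1 => E; rewrite -h1 -E -galM ?memvf // mulVg gal_id.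
by apply: contraNneq zy2 => E; rewrite -h2 -E -galM ?memvf // mulVg gal_id.
Qed.
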